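(* (Kelvin–Stokes' Curl Theorem) Let $U\subseteq\mathbb{R}^n$ be open and $0\le k\le n-1$. Then $$\oint_{\partial\perp J}\omega=\oint_J\star d\omega$$ for all matching pairs $J\in\hat{\mathcal B}_{n-k-1}^{r-1}(U)$, $\omega\in\mathcal B_k^r(U)$, and $1\le r\le\infty$ (where $\infty-1=\infty$).
   Context: Let $U\subseteq\mathbb{R}^n$ be open, fix an inner product on $\mathbb{R}^n$, and let $\Lambda_k$ be the $k$-th exterior power of $\mathbb{R}^n$. The mass of a simple $k$-vector $\alpha=v_1\wedge\cdots\wedge v_k$ is $\|\alpha\|=\sqrt{\det(\langle v_i,v_j\rangle)}$; for a general $k$-vector, $\|\alpha\|=\inf\{\sum_i\|\alpha_i\|:\alpha_i\text{ simple},\ \alpha=\sum_i\alpha_i\}$. $\mathcal A_k(U)$ (Dirac $k$-chains) is the vector space of finitely supported functions $U\to\Lambda_k$, written as finite formal sums $\sum_i(p_i;\alpha_i)$. Let $T_u(p;\alpha)=(p+u;\alpha)$, $\Delta_u=T_u-I$. For a list $\sigma^j=\{u_1,\dots,u_j\}$ of vectors put $\Delta_{\sigma^j}(p;\alpha)=\Delta_{u_j}\circ\cdots\circ\Delta_{u_1}(p;\alpha)$ and $\|\sigma^j\|=\|u_1\|\cdots\|u_j\|$; for $j=0$, $\Delta_{\emptyset}(p;\alpha)=(p;\alpha)$ and $\|\sigma^0\|=1$. $\Delta_{\sigma^j}(p;\alpha)$ is inside $U$ if the convex hull of its support is contained in $U$. For an integer $r\ge0$ and $A\in\mathcal A_k(U)$,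 $$\|A\|_{B^r}=\inf\Big\{\sum_i\|\sigma_i^{j(i)}\|\|\alpha_i\| : A=\sum_i\Delta_{\sigma_i^{j(i)}}(p_i;\alpha_i)\ \text{(finite sum)},\ 0\le j(i)\le r,\ \text{each term inside }U\Big\}.$$ $\hat{\mathcal B}_k^r(U)$ is the completion of $\mathcal A_k(U)$ in this norm. For $r\le s$ the identity on Dirac chains extends to an injective continuous linking map $\hat{\mathcal B}_k^r(U)\to\hat{\mathcal B}_k^s(U)$; $\hat{\mathcal B}_k(U)=\hat{\mathcal B}_k^\infty(U)$ is the locally convex inductive limit as $r\to\infty$. For a linear functional $\omega$ on $\mathcal A_k(U)$ (a differential $k$-form) let $|\omega|_{B^j}=\sup\{|\omega(\Delta_{\sigma^j}(p;\alpha))| : \|\sigma^j\|\|\alpha\|=1,\ \Delta_{\sigma^j}(p;\alpha)\text{ inside }U\}$ and $\|\omega\|_{B^r}=\max_{0\le j\le r}|\omega|_{B^j}$; $\mathcal B_k^r(U)$ is the space of $\omega$ with $\|\omega\|_{B^r}<\infty$, and $\mathcal B_k^\infty(U)=\bigcap_r\mathcal B_k^r(U)$. Each $\omega\in\mathcal B_k^r(U)$ extends continuously to $\hat{\mathcal B}_k^r(U)$ ($0\le r\le\infty$), and $\oint_J\omega:=\omega(J)$. $d$ is the usual exterior derivative. For $v\in\mathbb{R}^n$: $E_v(p;\alpha)=(p;v\wedge\alpha)$; $E_v^\dagger(p;v_1\wedge\cdots\wedge v_k)=\sum_{i=1}^k(-1)^{i+1}\langle v,v_i\rangle(p;v_1\wedge\cdots\wedge\widehat{v_i}\wedge\cdots\wedge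 v_k)$; $P_v(p;\alpha)=\lim_{t\to0}\big[(p+tv;\alpha/t)-(p;\alpha/t)\big]$ (limit in $\hat{\mathcal B}_k^2(U)$). All extend to differential chains by linearity and limits of Dirac chains, with $P_v:\hat{\mathcal B}_k^r(U)\to\hat{\mathcal B}_k^{r+1}(U)$. For an orthonormal basis $e_1,\dots,e_n$ of $\mathbb{R}^n$, the boundary is $\partial:=\sum_{i=1}^nP_{e_i}E_{e_i}^\dagger:\hat{\mathcal B}_k^r(U)\to\hat{\mathcal B}_{k-1}^{r+1}(U)$, and perpendicular complement is $\perp:=C_{e_n}\circ\cdots\circ C_{e_1}:\hat{\mathcal B}_k^r(U)\to\hat{\mathcal B}_{n-k}^r(U)$ with $C_v=E_v+E_v^\dagger$. The Hodge star on forms is, in this convention, $\star\omega:=\omega\circ\perp$.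
   Formalization: For r=1 the form ω is also required to lie in B_k^2(U), and the boundary of an order-0 chain is taken in order 2: as stated, ∂⊥J need not lie in B̂^1 and dω need not exist at the atoms of J (e.g. ω=|x| near 0, J the atom at 0). *)

(* Defs.v *)
(** Dirac chains, differential chains and differential forms on an open subset
    of R^n, over MathComp-Analysis.  The first part completes an arbitrary
    seminormed space by classes of Cauchy sequences. *)
From HB Require Import structures.
From mathcomp Require Import all_boot all_order all_algebra.
From mathcomp Require Import sesquilinear.
From mathcomp Require Import all_classical all_reals all_analysis.
Import Order.TTheory GRing.Theory Num.Theory.
Import numFieldNormedType.Exports.
Set Implicit Arguments.
Unset Strict Implicit.
Unset Printing Implicit Defensive.
Local Open Scope classical_set_scope.
Local Open Scope ring_scope.
Local Open Scope quotient_scope.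

Record seminorm (R : realType) (V : lmodType R) := Seminorm {
  snorm :> V -> R;
  snormD : forall x y, snorm (x + y) <= snorm x + snorm y;
  snormZ : forall (a : R) x, snorm (a *: x) = `|a| * snorm x }.

Section SeminormTheory.
Context {R : realType} {V : lmodType R} (N : seminorm V).

Lemma snorm0 : N 0 = 0.
Proof. by rewrite -(scale0r 0) snormZ normr0 mul0r. Qed.

Lemma snormN x : N (- x) = N x.
Proof. by rewrite -scaleN1r snormZ normrN normr1 mul1r. Qed.

Lemma snorm_ge0 x : 0 <= N x.
Proof.
have := snormD N x (- x); rewrite subrr snorm0 snormN -mulr2n.
by rewrite pmulrn_lge0.
Qed.

Lemma snormB x y : N (x - y) = N (y - x).
Proof. by rewrite -opprB snormN. Qed.

Lemma snorm_tri x y z : N (x - z) <= N (x - y) + N (y - z).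
Proof. by have := snormD N (x - y) (y - z); rewrite subrKA. Qed.

Lemma snorm_dist x y : `|N x - N y| <= N (x - y).
Proof.
rewrite ler_norml lerNl opprB !lerBlDr; apply/andP; split.
  by have := snormD N (y - x) x; rewrite subrK snormB.
by have := snormD N (x - y) y; rewrite subrK.
Qed.

End SeminormTheory.

Section CauchySequences.
Context {R : realType} {V : lmodType R} (N : seminorm V).

Definition cauchy_pred : pred (nat -> V) := fun u =>
  `[< forall e : R, 0 < e -> exists m, forall i j,
        (m <= i)%N -> (m <= j)%N -> N (u i - u j) < e >].

Lemma cauchy_pred_submod : GRing.submod_closed cauchy_pred.
Proof.
split=> [|a u v /asboolP cu /asboolP cv]; apply/asboolP => e e0.
  by exists 0%N => i j _ _; rewrite /= subrr snorm0.
have a1 : 0 < `|a| + 1 by rewrite ltr_wpDl.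
have [m1 m1P] := cu (e / 2 / (`|a| + 1)) (divr_gt0 (divr_gt0 e0 (ltr0Sn _ 1)) a1).
have [m2 m2P] := cv (e / 2) (divr_gt0 e0 (ltr0Sn _ 1)).
exists (maxn m1 m2) => i j; rewrite !geq_max => /andP[i1 i2] /andP[j1 j2] /=.
have -> : (a *: u + v) i - (a *: u + v) j = a *: (u i - u j) + (v i - v j).
  by rewrite /= scalerBr opprD addrACA.
apply: (le_lt_trans (snormD _ _ _)); rewrite [ltRHS](splitr e).
apply: ler_ltD; last exact: m2P.
rewrite snormZ -[leRHS](divfK (lt0r_neq0 a1)) mulrC ler_pM ?snorm_ge0//.
  exact/ltW/m1P.
by rewrite lerDl.
Qed.

HB.instance Definition _ := GRing.isSubmodClosed.Build R (nat -> V)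
  cauchy_pred cauchy_pred_submod.

Record cauchy_seq := CauchySeq { cs_val :> nat -> V; _ : cs_val \in cauchy_pred }.

HB.instance Definition _ := [isSub for cs_val].
HB.instance Definition _ := [Choice of cauchy_seq by <:].
HB.instance Definition _ :=
  [SubChoice_isSubLmodule of cauchy_seq by <:].

End CauchySequences.

Section Completion.
Context {R : realType} {V : lmodType R} (N : seminorm V).
Implicit Types (u v w : cauchy_seq N) (x y : V).

Lemma cauchy_seqP u (e : R) : 0 < e -> exists m, forall i j,
  (m <= i)%N -> (m <= j)%N -> N (u i - u j) < e.
Proof. by case: u => u /= /asboolP; apply. Qed.

Lemma cauchy_seqD u v i : (u + v) i = u i + v i. Proof. by []. Qed.
Lemma cauchy_seqN u i : (- u) i = - u i. Proof. by []. Qed.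
Lemma cauchy_seqB u v i : (u - v) i = u i - v i. Proof. by []. Qed.
Lemma cauchy_seqZ (a : R) u i : (a *: u) i = a *: u i. Proof. by []. Qed.

Definition cs_norm u : R := limn (N \o u).

Lemma cs_norm_cvg u : N \o u @ \oo --> cs_norm u.
Proof.
apply: cauchy_cvg; apply/cauchy_ballP => e e0.
have [m mP] := cauchy_seqP u e0; rewrite near_map2.
near=> i j; rewrite /ball/= (le_lt_trans (snorm_dist _ _ _))//.
by apply: mP; [near: i|near: j]; exact: nbhs_infty_ge.
Unshelve. all: by end_near. Qed.

Lemma cs_norm_ge0 u : 0 <= cs_norm u.
Proof.
apply: (cvgr_to_ge (@cs_norm_cvg u)); near=> i; exact: snorm_ge0.
Unshelve. all: by end_near. Qed.

Lemma cs_normD u v : cs_norm (u + v) <= cs_norm u + cs_norm v.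
Proof.
apply: ler_cvg_to (@cs_norm_cvg _) (cvgD (@cs_norm_cvg u) (@cs_norm_cvg v)) _.
near=> i; exact: snormD.
Unshelve. all: by end_near. Qed.

Lemma cs_normZ (a : R) u : cs_norm (a *: u) = `|a| * cs_norm u.
Proof.
apply: (cvg_unique _ (@cs_norm_cvg _)) => //=.
rewrite (_ : _ \o _ = fun i => `|a| * (N \o u) i); first exact: cvgMl_tmp (@cs_norm_cvg u).
by apply/funext => i; exact: snormZ.
Qed.

Lemma cs_norm0 : cs_norm 0 = 0.
Proof. by rewrite -(scale0r 0) cs_normZ normr0 mul0r. Qed.

Lemma cs_normN u : cs_norm (- u) = cs_norm u.
Proof. by rewrite -scaleN1r cs_normZ normrN normr1 mul1r. Qed.

Lemma cs_norm_eventually u (e : R) :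
  (\forall i \near \oo, N (u i) <= e) -> cs_norm u <= e.
Proof. exact: cvgr_to_le (@cs_norm_cvg u). Qed.

Definition cs_equiv u v := cs_norm (u - v) == 0.

Lemma cs_equiv_equiv : equiv_class_of cs_equiv.
Proof.
split=> [u|u v|v u w]; rewrite /cs_equiv.
- by rewrite subrr cs_norm0.
- by rewrite -cs_normN opprB.
- move=> /eqP uv /eqP vw; rewrite eq_le cs_norm_ge0 andbT.
  rewrite -(subrKA v); apply: (le_trans (cs_normD _ _)).
  by rewrite uv vw addr0.
Qed.

Canonical cs_equiv_equiv_rel := EquivRelPack cs_equiv_equiv.

(** Cauchy sequences modulo null sequences; below it is made a
    [completeNormedModType] into which [V] embeds densely and isometrically
    ([embed_norm], [embed_dense]). *)
Definition completion : Type := {eq_quot cs_equiv}.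

HB.instance Definition _ := Choice.on completion.
HB.instance Definition _ := EqQuotient.on completion.

Implicit Types p q : completion.

Definition cpl_of u : completion := \pi u.

Lemma cpl_eqP u v : cpl_of u = cpl_of v <-> cs_norm (u - v) = 0.
Proof. by split=> [/eqmodP/eqP//|uv]; apply/eqmodP/eqP. Qed.

Lemma cpl_reprK q : cpl_of (repr q) = q. Proof. exact: reprK. Qed.

Lemma cpl_ind (P : completion -> Prop) : (forall u, P (cpl_of u)) -> forall q, P q.
Proof. by move=> H q; rewrite -(cpl_reprK q). Qed.

Definition cpl_add p q := cpl_of (repr p + repr q).
Definition cpl_opp p := cpl_of (- repr p).
Definition cpl_scale (a : R) p := cpl_of (a *: repr p).
Definition cpl_norm p := cs_norm (repr p).

Lemma cs_norm_repr u : cs_norm (repr (cpl_of u) - u) = 0.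
Proof. by apply/cpl_eqP; rewrite cpl_reprK. Qed.

Lemma cs_norm_eq u v : cs_norm (u - v) = 0 -> cs_norm u = cs_norm v.
Proof.
move=> uv; apply/eqP; rewrite eq_le; apply/andP; split.
  by have := cs_normD (u - v) v; rewrite subrK uv add0r.
by have := cs_normD (v - u) u; rewrite subrK -(cs_normN (v - u)) opprB uv add0r.
Qed.

Lemma cpl_addE u v : cpl_add (cpl_of u) (cpl_of v) = cpl_of (u + v).
Proof.
apply/cpl_eqP/eqP; rewrite eq_le cs_norm_ge0 andbT opprD addrACA.
by rewrite (le_trans (cs_normD _ _))// !cs_norm_repr addr0.
Qed.

Lemma cpl_oppE u : cpl_opp (cpl_of u) = cpl_of (- u).
Proof. by apply/cpl_eqP; rewrite -opprD cs_normN cs_norm_repr. Qed.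

Lemma cpl_scaleE (a : R) u : cpl_scale a (cpl_of u) = cpl_of (a *: u).
Proof. by apply/cpl_eqP; rewrite -scalerBr cs_normZ cs_norm_repr mulr0. Qed.

Lemma cpl_normE u : cpl_norm (cpl_of u) = cs_norm u.
Proof. exact/cs_norm_eq/cs_norm_repr. Qed.

Fact cpl_addA : associative cpl_add.
Proof.
by elim/cpl_ind=> u; elim/cpl_ind=> v; elim/cpl_ind=> w; rewrite !cpl_addE addrA.
Qed.

Fact cpl_addC : commutative cpl_add.
Proof. by elim/cpl_ind=> u; elim/cpl_ind=> v; rewrite !cpl_addE addrC. Qed.

Fact cpl_add0 : left_id (cpl_of 0) cpl_add.
Proof. by elim/cpl_ind=> u; rewrite cpl_addE add0r. Qed.

Fact cpl_addN : left_inverse (cpl_of 0) cpl_opp cpl_add.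
Proof. by elim/cpl_ind=> u; rewrite cpl_oppE cpl_addE addNr. Qed.

HB.instance Definition _ :=
  GRing.isZmodule.Build completion cpl_addA cpl_addC cpl_add0 cpl_addN.

Lemma cpl_ofD u v : cpl_of (u + v) = cpl_of u + cpl_of v.
Proof. by rewrite -cpl_addE. Qed.

Lemma cpl_ofN u : cpl_of (- u) = - cpl_of u.
Proof. by rewrite -cpl_oppE. Qed.

Fact cpl_scaleA (a b : R) p : cpl_scale a (cpl_scale b p) = cpl_scale (a * b) p.
Proof. by elim/cpl_ind: p => u; rewrite !cpl_scaleE scalerA. Qed.

Fact cpl_scale1 : left_id 1 cpl_scale.
Proof. by elim/cpl_ind=> u; rewrite cpl_scaleE scale1r. Qed.

Fact cpl_scaleDr : right_distributive cpl_scale +%R.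
Proof.
move=> a; elim/cpl_ind=> u; elim/cpl_ind=> v.
by rewrite -cpl_ofD !cpl_scaleE -cpl_ofD scalerDr.
Qed.

Fact cpl_scaleDl p : {morph cpl_scale^~ p : a b / a + b}.
Proof. by elim/cpl_ind: p => u a b /=; rewrite !cpl_scaleE -cpl_ofD scalerDl. Qed.

HB.instance Definition _ := GRing.Zmodule_isLmodule.Build R completion
  cpl_scaleA cpl_scale1 cpl_scaleDr cpl_scaleDl.

Lemma cpl_ofZ (a : R) u : cpl_of (a *: u) = a *: cpl_of u.
Proof. by rewrite -cpl_scaleE. Qed.

Fact cpl_normD p q : cpl_norm (p + q) <= cpl_norm p + cpl_norm q.
Proof.
elim/cpl_ind: p => u; elim/cpl_ind: q => v.
by rewrite -cpl_ofD !cpl_normE cs_normD.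
Qed.

Fact cpl_normZ (a : R) p : cpl_norm (a *: p) = `|a| * cpl_norm p.
Proof. by elim/cpl_ind: p => u; rewrite -cpl_ofZ !cpl_normE cs_normZ. Qed.

Fact cpl_norm_eq0 p : cpl_norm p = 0 -> p = 0.
Proof.
elim/cpl_ind: p => u; rewrite cpl_normE => u0.
by apply/cpl_eqP; rewrite subr0.
Qed.

HB.instance Definition _ :=
  Lmodule_isNormed.Build R completion cpl_normD cpl_normZ cpl_norm_eq0.

Lemma cpl_of_norm u : `|cpl_of u| = cs_norm u. Proof. exact: cpl_normE. Qed.

Fact cst_cauchy x : (fun=> x) \in cauchy_pred N.
Proof. by apply/asboolP => e e0; exists 0%N => *; rewrite subrr snorm0. Qed.

Definition embed x : completion := cpl_of (CauchySeq (cst_cauchy x)).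

Fact embed_linear : linear embed.
Proof.
move=> a x y; rewrite /embed -cpl_ofZ -cpl_ofD; congr cpl_of; exact/val_inj.
Qed.
HB.instance Definition _ :=
  GRing.isLinear.Build R V completion _ embed embed_linear.

Lemma embed_norm x : `|embed x| = N x.
Proof.
rewrite /embed cpl_of_norm; apply: (cvg_unique _ (@cs_norm_cvg _)) => //=.
exact: cvg_cst.
Qed.

Lemma embed_cvg u : embed (u i) @[i --> \oo] --> cpl_of u.
Proof.
apply/cvgrPdist_le => e e0; have [m mP] := cauchy_seqP u e0.
near=> i; rewrite /embed -cpl_ofN -cpl_ofD cpl_of_norm.
apply: cs_norm_eventually; near=> j; apply/ltW/mP.
  by near: j; exact: nbhs_infty_ge.
by near: i; exact: nbhs_infty_ge.
Unshelve. all: by end_near. Qed.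

Lemma embed_dense p (e : R) : 0 < e -> exists x, `|p - embed x| < e.
Proof.
elim/cpl_ind: p => u e0.
have /cvgrPdist_lt/(_ _ e0)[m _ mP] := embed_cvg (u := u).
by exists (u m); exact: (mP m) (leqnn m).
Qed.

Fact completion_complete (F : set_system completion) :
  ProperFilter F -> cauchy F -> cvg F.
Proof.
move=> FF /cauchyP Fc.
have i0 (i : nat) : 0 < i.+1%:R^-1 :> R by rewrite invr_gt0.
have /choice[x xP] (i : nat) :
    exists x, F (ball (embed x) (i.+1%:R^-1 + i.+1%:R^-1)).
  have [p pF] := Fc _ (i0 i); have [x px] := embed_dense p (i0 i).
  exists x; apply: filterS pF => q; apply: ball_triangle.
  by rewrite -ball_normE/= distrC.
pose a (i : nat) : R := i.+1%:R^-1 + i.+1%:R^-1.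
have a0 : a @ \oo --> 0.
  by rewrite -[0](addr0 0); apply: cvgD; exact: cvg_harmonic.
have xc : x \in cauchy_pred N.
  apply/asboolP => e e0.
  have /cvgrPdist_lt/(_ (e / 2))[|m _ mP] := a0; first by rewrite divr_gt0.
  exists m => i j mi mj; 
  have /filter_ex[q []] : F (_ `&` _) := @filterI _ F (@filter_filter _ F FF) _ _ (xP i) (xP j); rewrite -!ball_normE/= => qi qj.
  rewrite -embed_norm linearB/= -(subrKA q).
  rewrite (le_lt_trans (ler_normD _ _))// [ltRHS](splitr e) ltrD//.
    apply: (lt_le_trans qi); move: (mP i mi); rewrite /= sub0r normrN => /ltW.
    exact/le_trans/ler_norm.
  rewrite distrC; apply: (lt_le_trans qj); move: (mP j mj).
  rewrite /= sub0r normrN => /ltW; exact/le_trans/ler_norm.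
apply/cvg_ex; exists (cpl_of (CauchySeq xc)); apply/cvgrPdist_lt => e e0.
have e20 : 0 < e / 2 by rewrite divr_gt0.
have /cvgrPdist_lt/(_ _ e20) H1 := @embed_cvg (CauchySeq xc).
have /cvgrPdist_lt/(_ _ e20) H2 := a0.
have [m _ /(_ m (leqnn m))[/= m1 m2]] 
  := filterI H1 H2.
apply: filterS (xP m) => q; rewrite -ball_normE/= => qm.
rewrite -(subrKA (embed (x m))) (le_lt_trans (ler_normD _ _))//.
rewrite [ltRHS](splitr e) ltrD//; apply: (lt_trans qm).
by move: m2; rewrite /= sub0r normrN; exact/le_lt_trans/ler_norm.
Qed.

HB.instance Definition _ := Uniform_isComplete.Build completion
  completion_complete.

End Completion.

Section Extension.
Context {R : realType} {V : lmodType R} (N : seminorm V).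

(** The trace on [V] of the neighbourhoods of [p]. *)
Definition embed_nbhs (p : completion N) : set_system V :=
  filter_from (nbhs p) (fun B => embed N @^-1` B).

(** Extension by continuity; a junk value where the limit does not exist. *)
Definition extend {W : normedModType R} (f : V -> W) (p : completion N) : W :=
  lim (f @ embed_nbhs p).

#[global] Instance embed_nbhs_filter p : ProperFilter (embed_nbhs p).
Proof.
apply: filter_from_proper.
  apply: filter_from_filter; first by exists setT; exact: filterT.
  by move=> A B pA pB; exists (A `&` B); [exact: filterI|].
move=> A /nbhs_ballP[e /= e0 eA]; have [x px] := embed_dense p e0.
by exists x; apply: eA; rewrite -ball_normE.
Qed.

Lemma embed_nbhs_cvg p : embed N @ embed_nbhs p --> p.
Proof. by move=> B pB; exists B. Qed.

Context {W : completeNormedModType R} (f : {linear V -> W}).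
Context (f1 : forall x, `|f x| <= N x).

Lemma extend_cvg p : f @ embed_nbhs p --> extend f p.
Proof.
apply: cauchy_cvg; apply/cauchyP => e e0.
have [x px] := embed_dense p e0; exists (f x).
exists (ball p (e - `|p - embed N x|)).
  by apply: nbhsx_ballx; rewrite subr_gt0.
move=> y /=; rewrite -!ball_normE/= ltrBrDr => py.
rewrite -linearB (le_lt_trans (f1 _))// -embed_norm linearB/=.
rewrite (le_lt_trans _ py)// [leRHS]addrC (distrC p (embed N x)).
exact: ler_distD.
Qed.

Lemma extend_bound p x : `|extend f p - f x| <= `|p - embed N x|.
Proof.
have H1 : `|f y - f x| @[y --> embed_nbhs p] --> `|extend f p - f x|.
  by apply: cvg_norm; apply: cvgB; [exact: (@extend_cvg p)|exact: cvg_cst].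
have H2 : `|embed N y - embed N x| @[y --> embed_nbhs p] --> `|p - embed N x|.
  by apply: cvg_norm; apply: cvgB; [exact: (@embed_nbhs_cvg p)|exact: cvg_cst].
rewrite -subr_ge0; apply: (cvgr_to_ge (cvgB H2 H1)); near=> y; rewrite subr_ge0.
by rewrite -!linearB/= embed_norm.
Unshelve. all: by end_near. Qed.

Lemma extend_embed x : extend f (embed N x) = f x.
Proof.
by apply/eqP; rewrite -subr_eq0 -normr_le0 -(normr0 (completion N))
  -(subrr (embed N x)) extend_bound.
Qed.

Lemma extend_unique p (l : W) :
  (forall x, `|l - f x| <= `|p - embed N x|) -> extend f p = l.
Proof.
move=> lP; apply/eqP; rewrite -subr_eq0 -normr_le0; apply/ler_addgt0Pr => e e0.
have [x px] := embed_dense p (divr_gt0 e0 (ltr0Sn R 1)).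
rewrite add0r (le_trans (ler_distD (f x) _ _))// [leRHS](splitr e).
rewrite lerD//; first exact: le_trans (extend_bound _ _) (ltW px).
by rewrite distrC; exact: le_trans (lP x) (ltW px).
Qed.

End Extension.

Section ExteriorPower.
Context {R : realType} {n : nat}.

(** Strictly increasing k-tuples of indices in {0,...,n-1}. *)
Definition multi_index k :=
  {f : {ffun 'I_k -> 'I_n} | [forall i : 'I_k, forall j : 'I_k, (i < j)%N ==> (f i < f j)%N]}.

(** The k-th exterior power of R^n, in coordinates on the basis
    e_(f 0) /\ ... /\ e_(f (k-1)), f a multi-index. *)
Definition ext k : Type := {ffun multi_index k -> R^o}.
HB.instance Definition _ k := GRing.Lmodule.on (ext k).

(** The exterior product of the rows of [A]: its coordinates are the maximal
    minors of [A]. *)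
Definition wedge k (A : 'M[R]_(k, n)) : ext k :=
  [ffun f : multi_index k => \det (colsub (val f) A) : R^o].

Definition basis_mx k (f : multi_index k) : 'M[R]_(k, n) := rowsub (val f) 1%:M.

(** v /\ a, extended linearly from a = e_(f 0) /\ ... /\ e_(f (k-1)). *)
Definition ext_mul k (v : 'rV[R]_n) (a : ext k) : ext k.+1 :=
  \sum_f a f *: wedge (col_mx v (basis_mx f)).

(** v_1 /\ ... /\ v_(k+1) |-> \sum_i (-1)^(i+1) <v, v_i> v_1 /\ .. ^v_i .. /\ v_(k+1),
    extended linearly from the basis; the sign is [(-1) ^+ i] because indices
    start at 0. *)
Definition ext_int (ip : 'rV[R]_n -> 'rV[R]_n -> R) k (v : 'rV[R]_n)
    (a : ext k.+1) : ext k :=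
  \sum_f a f *: \sum_(i < k.+1)
    ((-1) ^+ i * ip v (row i (basis_mx f))) *: wedge (row' i (basis_mx f)).

Definition gram (ip : 'rV[R]_n -> 'rV[R]_n -> R) k (A : 'M[R]_(k, n)) : R :=
  \det (\matrix_(i < k, j < k) ip (row i A) (row j A)).

(** Infimum over the decompositions into simple k-vectors [c *: wedge A], of mass
    |c| sqrt (gram A).  The coefficient c can be absorbed in a row of [A] when
    k > 0; it is needed for k = 0, where every scalar is simple. *)
Definition mass (ip : 'rV[R]_n -> 'rV[R]_n -> R) k (a : ext k) : R :=
  inf [set s | exists2 l : seq (R * 'M[R]_(k, n)),
    a = \sum_(t <- l) t.1 *: wedge t.2 &
    s = \sum_(t <- l) `|t.1| * Num.sqrt (gram ip t.2)].

Definition vnorm (ip : 'rV[R]_n -> 'rV[R]_n -> R) (v : 'rV[R]_n) : R :=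
  Num.sqrt (ip v v).

Lemma ext_mul0 k v : @ext_mul k v 0 = 0.
Proof. by rewrite /ext_mul big1// => f _; rewrite ffunE scale0r. Qed.

Lemma ext_int0 ip k v : @ext_int ip k v 0 = 0.
Proof. by rewrite /ext_int big1// => f _; rewrite ffunE scale0r. Qed.

Lemma mass_ge0 ip k (a : ext k) : 0 <= mass ip a.
Proof.
rewrite /mass; set S := [set s | _].
have [->|/set0P S0] := eqVneq S set0; first by rewrite inf0.
apply: lb_le_inf => // s [l _ ->].
by apply: sumr_ge0 => t _; rewrite mulr_ge0// sqrtr_ge0.
Qed.

Lemma massZ ip k (c : R) (a : ext k) : mass ip (c *: a) <= `|c| * mass ip a.
Proof.
pose M (b : ext k) := [set s | exists2 l : seq (R * 'M[R]_(k, n)),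
  b = \sum_(t <- l) t.1 *: wedge t.2 &
  s = \sum_(t <- l) `|t.1| * Num.sqrt (gram ip t.2)].
have lbM b : lbound (M b) 0.
  by move=> s [l _ ->]; apply: sumr_ge0 => t _; rewrite mulr_ge0// sqrtr_ge0.
have MZ d b s : M b s -> M (d *: b) (`|d| * s).
  move=> [l -> ->]; exists [seq (d * t.1, t.2) | t <- l].
    by rewrite big_map scaler_sumr; apply: eq_bigr => t _; rewrite scalerA.
  by rewrite big_map mulr_sumr; apply: eq_bigr => t _; rewrite normrM mulrA.
have hM b : has_lbound (M b) by exists 0; exact: lbM.
have [->|c0] := eqVneq c 0.
  rewrite scale0r normr0 mul0r; apply: (ge_inf (hM 0)).
  by exists [::]; rewrite big_nil.
have [[s0 s0M]|M0] := pselect (M a !=set0); last first.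
  rewrite /mass -/(M a) -/(M (c *: a)); have -> : M a = set0.
    by apply/eqP; apply: contrapT => /negP/set0P.
  have -> : M (c *: a) = set0.
    apply/eqP; apply: contrapT => /negP/set0P[s /(MZ c^-1)].
    by rewrite scalerA mulVf// scale1r => sM; apply: M0; eexists; exact: sM.
  by rewrite inf0 mulr0.
rewrite -ler_pdivrMl ?normr_gt0//; apply: lb_le_inf; first by exists s0.
by move=> s sM; rewrite ler_pdivrMl ?normr_gt0//; apply: (ge_inf (hM _)); exact: MZ.
Qed.

End ExteriorPower.
Arguments ext R n k : clear implicits.

Section DiracChains.
Context {R : realType} {n : nat}.
Implicit Types (k : nat) (U : set 'rV[R]_n) (p q u v : 'rV[R]_n).

Definition supp k (A : 'rV[R]_n -> ext R n k) : set 'rV[R]_n :=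
  [set p | A p != 0].

(** A Dirac k-chain in U is a function on the whole of R^n, with finite support
    contained in U. *)
Definition dirac_pred U k : pred ('rV[R]_n -> ext R n k) :=
  fun A => `[< finite_set (supp A) /\ supp A `<=` U >].

Lemma dirac_pred_submod U k : GRing.submod_closed (@dirac_pred U k).
Proof.
have s0 : supp (0 : 'rV[R]_n -> ext R n k) = set0.
  by apply/seteqP; split => p //=; rewrite /supp/= eqxx.
split=> [|c A B /asboolP[fA AU] /asboolP[fB BU]]; apply/asboolP.
  by rewrite s0; split.
have sAB : supp (c *: A + B) `<=` supp A `|` supp B.
  move=> p; rewrite /supp/=; have [A0|] := eqVneq (A p) 0; last by left.
  move=> cAB; right; apply: contra_neq cAB => B0.
  by rewrite -[LHS]/(c *: A p + B p) A0 B0 scaler0 addr0.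
split; last by move=> p /sAB [/AU|/BU].
by apply: sub_finite_set sAB _; rewrite finite_setU.
Qed.

HB.instance Definition _ U k := GRing.isSubmodClosed.Build R
  ('rV[R]_n -> ext R n k) (@dirac_pred U k) (@dirac_pred_submod U k).

Record dirac_chain U k := DiracChain {
  dirac_fun :> 'rV[R]_n -> ext R n k;
  _ : dirac_fun \in @dirac_pred U k }.

HB.instance Definition _ U k := [isSub for @dirac_fun U k].
HB.instance Definition _ U k := [Choice of dirac_chain U k by <:].
HB.instance Definition _ U k := [SubChoice_isSubLmodule of dirac_chain U k by <:].

Lemma dirac_map_subproof U k m (g : ext R n k -> ext R n m)
  (A : dirac_chain U k) : g 0 = 0 -> g \o A \in @dirac_pred U m.
Proof.
case: A => A /= /asboolP[fA AU] g0.
have sA : supp (g \o A) `<=` supp A.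
  by move=> p; apply: contra_neq => /= ->.
by apply/asboolP; split; [exact: sub_finite_set fA|exact: subset_trans AU].
Qed.

Definition dirac_map U k m (g : ext R n k -> ext R n m) (g0 : g 0 = 0)
  (A : dirac_chain U k) : dirac_chain U m := DiracChain (dirac_map_subproof A g0).

(** The chain (p; a); [translate u] is T_u, [delta u] is T_u - I and [deltas] applies
    the first vector of the list first. *)
Definition dirac k p (a : ext R n k) : 'rV[R]_n -> ext R n k :=
  fun q => if q == p then a else 0.

Definition translate k u (A : 'rV[R]_n -> ext R n k) : 'rV[R]_n -> ext R n k :=
  fun q => A (q - u).

Definition delta k u (A : 'rV[R]_n -> ext R n k) : 'rV[R]_n -> ext R n k :=
  translate u A - A.

Definition deltas k (s : seq 'rV[R]_n) (A : 'rV[R]_n -> ext R n k) :=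
  foldl (fun B u => delta u B) A s.

Definition convex_hull (S : set 'rV[R]_n) : set 'rV[R]_n :=
  \bigcap_(C in [set C : set (convex_lmodType 'rV[R]_n) |
                 convex_set C /\ S `<=` C]) C.

Definition inside U k (A : 'rV[R]_n -> ext R n k) :=
  convex_hull (supp A) `<=` U.

(** Cast to Dirac chains in U, with junk value 0. *)
Definition dirac_of U k (A : 'rV[R]_n -> ext R n k) : dirac_chain U k :=
  insubd 0 A.

Lemma deltasZ k s (c : R) (A : 'rV[R]_n -> ext R n k) :
  deltas s (c *: A) = c *: deltas s A.
Proof.
elim: s A => //= u s IH A; rewrite -IH; congr deltas.
by apply/funext => q; rewrite /delta/translate/= scalerBr.
Qed.

Lemma diracZ k p (c : R) (a : ext R n k) : dirac p (c *: a) = c *: dirac p a.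
Proof.
apply/funext => q; rewrite /dirac -[RHS]/(c *: _).
by case: ifP; rewrite ?scaler0.
Qed.

Lemma insideZ U k (c : R) (A : 'rV[R]_n -> ext R n k) :
  inside U A -> inside U (c *: A).
Proof.
move=> AU p pA; apply: AU => C [cC AC]; apply: pA; split=> // q qA.
apply: AC; apply: contra_neq qA => qA.
by rewrite -[LHS]/(c *: A q) qA scaler0.
Qed.

Lemma inside_dirac U k p (a : ext R n k) : U p -> inside U (dirac p a).
Proof.
move=> Up q qA; suff -> : q = p by [].
apply: (qA [set p]); split=> [x y l|z]; last by rewrite /supp/dirac/=; case: (z =P p) => //; rewrite eqxx.
by rewrite !inE/= => -> ->; rewrite convmm.
Qed.

End DiracChains.

Section Bnorm.
Context {R : realType} {n : nat} (ip : 'rV[R]_n -> 'rV[R]_n -> R).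
Context (U : set 'rV[R]_n) (r k : nat).

(** The data (sigma, p, a) of a term Delta_sigma (p; a). *)
Definition dterm : Type := (seq 'rV[R]_n * 'rV[R]_n * ext R n k)%type.

Definition dterm_chain (t : dterm) : 'rV[R]_n -> ext R n k :=
  deltas t.1.1 (dirac t.1.2 t.2).

Definition dterm_mass (t : dterm) : R :=
  (\prod_(u <- t.1.1) vnorm ip u) * mass ip t.2.

Definition decomposition (A : 'rV[R]_n -> ext R n k) (l : seq dterm) :=
  [/\ A = \sum_(t <- l) dterm_chain t,
      {in l, forall t : dterm, (size t.1.1 <= r)%N} &
      {in l, forall t : dterm, inside U (dterm_chain t)}].

Definition decomposition_masses (A : 'rV[R]_n -> ext R n k) : set R :=
  [set s | exists2 l, decomposition A l & s = \sum_(t <- l) dterm_mass t].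

Definition Bnorm (A : dirac_chain U k) : R := inf (decomposition_masses A).

Lemma decomposition_masses_ge0 A : lbound (decomposition_masses A) 0.
Proof.
move=> s [l _ ->]; apply: sumr_ge0 => t _; rewrite mulr_ge0 ?mass_ge0//.
by apply: prodr_ge0 => u _; exact: sqrtr_ge0.
Qed.

Lemma decomposition_masses_lb A : has_lbound (decomposition_masses A).
Proof. by exists 0; exact: decomposition_masses_ge0. Qed.

Lemma decomposition_masses_neq0 (A : dirac_chain U k) :
  decomposition_masses A !=set0.
Proof.
case: A => A Adir; have /asboolP[/finite_seqP[s0 sA] AU] := Adir.
pose s := undup s0.
have {}sA : supp A = [set` s].
  by rewrite sA; apply/seteqP; split=> p /=; rewrite mem_undup.
pose l : seq dterm := [seq ([::], p, A p) | p <- s].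
exists (\sum_(t <- l) dterm_mass t), l => //; split.
- apply/funext => q; rewrite /= big_map fct_sumE /dterm_chain/dirac/=.
  have [qs|qs] := boolP (q \in s).
    rewrite (bigD1_seq q) ?undup_uniq//= eqxx big1 ?addr0// => p.
    by rewrite eq_sym => /negbTE ->.
  rewrite big_seq big1 => [|p ps].
    apply/eqP; apply: contraNT qs => qA.
    by have : supp A q by []; rewrite sA.
  by case: eqP => // qp; rewrite qp ps in qs.
- by move=> t /mapP[p _ ->].
- move=> t /mapP[p ps ->]; apply: inside_dirac; apply: AU.
  by rewrite sA.
Qed.

Fact BnormD A B : Bnorm (A + B) <= Bnorm A + Bnorm B.
Proof.
apply/ler_addgt0Pr => e e0; have e2 : 0 < e / 2 by rewrite divr_gt0.
have [a [la [Aa ra Ua] ->] aA] := inf_adherent e2 (conj (decomposition_masses_neq0 A) (decomposition_masses_lb A)).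
have [b [lb [Bb rb Ub] ->] bB] := inf_adherent e2 (conj (decomposition_masses_neq0 B) (decomposition_masses_lb B)).
apply: (@le_trans _ _ (\sum_(t <- la ++ lb) dterm_mass t)).
  apply: (ge_inf (decomposition_masses_lb _)); exists (la ++ lb) => //; split.
  - by rewrite big_cat/= -Aa -Bb.
  - by move=> t; rewrite mem_cat => /orP[/ra|/rb].
  - by move=> t; rewrite mem_cat => /orP[/Ua|/Ub].
rewrite big_cat/= [e in leRHS]splitr addrACA; exact/ltW/ltrD.
Qed.

Let BnormZ_le (c : R) A : Bnorm (c *: A) <= `|c| * Bnorm A.
Proof.
have H s : decomposition_masses A s -> Bnorm (c *: A) <= `|c| * s.
  move=> [l [Al rl Ul] ->].
  pose l' : seq dterm := [seq (t.1, c *: t.2) | t <- l].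
  have l'E t : dterm_chain (t.1, c *: t.2) = c *: dterm_chain t.
    by rewrite /dterm_chain/= diracZ deltasZ.
  apply: (@le_trans _ _ (\sum_(t <- l') dterm_mass t)).
    apply: (ge_inf (decomposition_masses_lb _)); exists l' => //; split.
    - rewrite big_map; under eq_bigr do rewrite l'E.
      by rewrite -scaler_sumr -Al.
    - by move=> t /mapP[t' /rl t'l ->].
    - by move=> t /mapP[t' /Ul t'l ->]; rewrite l'E; exact: insideZ.
  rewrite big_map mulr_sumr; apply: ler_sum => t _.
  rewrite /dterm_mass/= mulrCA ler_wpM2l ?massZ//.
  by apply: prodr_ge0 => u _; exact: sqrtr_ge0.
have [c0|c0] := eqVneq c 0.
  have [s sA] := decomposition_masses_neq0 A.
  by rewrite (le_trans (H _ sA))// c0 normr0 !mul0r.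
rewrite -ler_pdivrMl ?normr_gt0//; apply: lb_le_inf; first exact: decomposition_masses_neq0.
by move=> s /H; rewrite ler_pdivrMl// normr_gt0.
Qed.

Fact BnormZ (c : R) A : Bnorm (c *: A) = `|c| * Bnorm A.
Proof.
apply/eqP; rewrite eq_le BnormZ_le/=.
have [->|c0] := eqVneq c 0.
  by rewrite normr0 mul0r lb_le_inf//; [exact: decomposition_masses_neq0|exact: decomposition_masses_ge0].
rewrite -ler_pdivlMl ?normr_gt0// -normfV.
by rewrite -{1}(scale1r A) -(mulVf c0) -scalerA BnormZ_le.
Qed.

Definition Bseminorm : seminorm (dirac_chain U k) := Seminorm BnormD BnormZ.

(** The Banach space of differential k-chains of order r. *)
Definition Bhat : Type := completion Bseminorm.
HB.instance Definition _ := CompleteNormedModule.on Bhat.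

End Bnorm.

Section Link.
Context {R : realType} {n : nat} (ip : 'rV[R]_n -> 'rV[R]_n -> R).
Context (U : set 'rV[R]_n).

Lemma Bnorm_le r s k (A : dirac_chain U k) :
  (r <= s)%N -> Bnorm ip s A <= Bnorm ip r A.
Proof.
move=> rs; apply/ler_addgt0Pr => e e0.
have [a [la [Aa ra Ua] ->] aA] :=
  inf_adherent e0 (conj (decomposition_masses_neq0 ip r A)
                        (decomposition_masses_lb ip U r A)).
rewrite (le_trans _ (ltW aA))//.
apply: (ge_inf (decomposition_masses_lb ip U s A)); exists la => //; split=> //.
by move=> t /ra /leq_trans; apply.
Qed.

Definition Bembed r k : dirac_chain U k -> Bhat ip U r k :=
  embed (Bseminorm ip U r k).

(** Only meaningful for r <= s. *)
Definition link r s k : Bhat ip U r k -> Bhat ip U s k :=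
  extend (@Bembed s k).

Lemma link_bound r s k (J : Bhat ip U r k) A :
  (r <= s)%N -> `|link s J - Bembed s A| <= `|J - Bembed r A|.
Proof.
move=> rs; apply: extend_bound => B.
by rewrite embed_norm; exact: Bnorm_le.
Qed.

Lemma link_embed r s k (A : dirac_chain U k) :
  (r <= s)%N -> link s (Bembed r A) = Bembed s A.
Proof.
move=> rs; apply: extend_embed => B.
by rewrite embed_norm; exact: Bnorm_le.
Qed.

Lemma link_link r s t k (J : Bhat ip U r k) : (r <= s)%N -> (s <= t)%N ->
  link t (link s J) = link t J.
Proof.
move=> rs st; apply/esym/extend_unique => [B|A].
  by rewrite embed_norm; apply: Bnorm_le; exact: leq_trans st.
exact: le_trans (link_bound _ _ st) (link_bound _ _ rs).
Qed.

Definition link_equiv k (x y : {r & Bhat ip U r k}) : bool :=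
  `[< exists m, [/\ (tag x <= m)%N, (tag y <= m)%N &
        link m (tagged x) = link m (tagged y)] >].

Lemma link_equiv_equiv k : equiv_class_of (@link_equiv k).
Proof.
split=> [x|x y|y x z]; rewrite /link_equiv.
- by apply/asboolP; exists (tag x).
- suff H (x' y' : {r & Bhat ip U r k}) : link_equiv x' y' -> link_equiv y' x'.
    by apply/idP/idP; exact: H.
  move=> /asboolP[m [xm ym xy]]; apply/asboolP; exists m.
  by split; [exact: ym|exact: xm|exact: esym xy].
- move=> /asboolP[m [xm ym xy]] /asboolP[p [yp zp yz]].
  apply/asboolP; exists (maxn m p); split.
  + exact: leq_trans xm (leq_maxl m p).
  + exact: leq_trans zp (leq_maxr m p).
  + rewrite -(link_link _ xm (leq_maxl m p)) xy.
    rewrite -(link_link _ zp (leq_maxr m p)) -yz.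
    rewrite (link_link _ ym (leq_maxl m p)) (link_link _ yp (leq_maxr m p)).
    exact: erefl.
Qed.

Canonical link_equiv_rel k := EquivRelPack (@link_equiv_equiv k).

(** The inductive limit of the [Bhat r]: chains of arbitrary orders, identified
    when they become equal at some common larger order.  Operators and pairings
    are computed on a representative of finite order. *)
Definition Bhat_oo k : Type := {eq_quot @link_equiv k}.
HB.instance Definition _ k := Choice.on (Bhat_oo k).
HB.instance Definition _ k := EqQuotient.on (Bhat_oo k).

Definition oo_of r k (J : Bhat ip U r k) : Bhat_oo k := 
  \pi_(Bhat_oo k) (Tagged (fun s => Bhat ip U s k) J).

Definition oo_order k (J : Bhat_oo k) : nat := tag (repr J).
Definition oo_repr k (J : Bhat_oo k) : Bhat ip U (oo_order J) k := tagged (repr J).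

End Link.

Section GradedPerp.
Context {R : realType} {n : nat} (X : nat -> lmodType R).
Context (E : 'I_n -> forall k, X k -> X k.+1).
Context (Ed : 'I_n -> forall k, X k.+1 -> X k).

(** X is the sequence of homogeneous parts of a graded space; an element of the
    graded space is a family [forall k, X k]. *)
Definition in_degree m (a : X m) : forall k, X k := fun k =>
  if m =P k is ReflectT mk then ecast j (X j) mk a else 0.

(** C_(e_i) = E_(e_i) + E_(e_i)^dagger. *)
Definition clifford i (x : forall k, X k) : forall k, X k := fun k =>
  match k with 0 => 0 | j.+1 => E i (x j) end + Ed i (x k.+1).

(** The degree k part of C_(e_n) o ... o C_(e_1) at an element of degree m; it is
    nonzero only for k = n - m. *)
Definition graded_perp m k (a : X m) : X k :=
  foldl (fun x i => clifford i x) (in_degree a) (enum 'I_n) k.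

End GradedPerp.

Section Operators.
Context {R : realType} {n : nat} (ip : 'rV[R]_n -> 'rV[R]_n -> R).
Context (e : 'I_n -> 'rV[R]_n) (U : set 'rV[R]_n).
Implicit Types (r k m : nat) (u v : 'rV[R]_n).

Definition dirac_E v k : dirac_chain U k -> dirac_chain U k.+1 :=
  dirac_map (ext_mul0 k v).

Definition dirac_Ed v k : dirac_chain U k.+1 -> dirac_chain U k :=
  dirac_map (ext_int0 ip k v).

Definition dirac_perp m k : dirac_chain U m -> dirac_chain U k :=
  @graded_perp R n (dirac_chain U)
    (fun i => @dirac_E (e i)) (fun i => @dirac_Ed (e i)) m k.

Definition chain_E r v k : Bhat ip U r k -> Bhat ip U r k.+1 :=
  extend (fun A => Bembed ip r (dirac_E v A)).

Definition chain_Ed r v k : Bhat ip U r k.+1 -> Bhat ip U r k :=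
  extend (fun A => Bembed ip r (dirac_Ed v A)).

Definition perp r m k : Bhat ip U r m -> Bhat ip U r k :=
  @graded_perp R n (Bhat ip U r)
    (fun i => @chain_E r (e i)) (fun i => @chain_Ed r (e i)) m k.

(** The limit, in [Bhat 2], of (p + tv; a/t) - (p; a/t); the points where this
    is not supported in U are away from t = 0. *)
Definition dirac_P v k p (a : ext R n k) : Bhat ip U 2 k :=
  lim (Bembed ip 2 (dirac_of U (delta (t *: v) (dirac p (t^-1 *: a)))) @[t --> 0^']).

(** The limits defining P_v exist in order 2, not in order 1, whence the target
    order max(r + 1, 2), which is r + 1 as soon as r >= 1. *)
Definition chain_P r v k : Bhat ip U r k -> Bhat ip U (maxn r.+1 2) k :=
  extend (fun A : dirac_chain U k =>
    \sum_(p \in supp A) link (maxn r.+1 2) (dirac_P v p (A p))).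

Definition boundary r k (J : Bhat ip U r k.+1) : Bhat ip U (maxn r.+1 2) k :=
  \sum_(i < n) chain_P (e i) (chain_Ed (e i) J).

Definition perp_oo m k (J : Bhat_oo ip U m) : Bhat_oo ip U k :=
  oo_of (perp k (oo_repr J)).

Definition boundary_oo k (J : Bhat_oo ip U k.+1) : Bhat_oo ip U k :=
  oo_of (boundary (oo_repr J)).

End Operators.

Section Forms.
Context {R : realType} {n : nat} (ip : 'rV[R]_n -> 'rV[R]_n -> R).
Context (e : 'I_n -> 'rV[R]_n) (U : set 'rV[R]_n).
Implicit Types (r j k m : nat).

(** Supremum of |w (Delta_sigma (p; a))| over |sigma| |a| = 1, with j vectors in
    sigma and Delta_sigma (p; a) inside U. *)
Definition form_seminorm k j (w : dirac_chain U k -> R) : \bar R :=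
  ereal_sup [set x | exists t : dterm k,
    [/\ size t.1.1 = j, dterm_mass ip t = 1, inside U (dterm_chain t) &
        x = `|w (dirac_of U (dterm_chain t))|%:E]].

Definition form_norm k r (w : dirac_chain U k -> R) : \bar R :=
  \big[maxe/0%E]_(j < r.+1) form_seminorm j w.

Definition Bform k r (w : dirac_chain U k -> R) : Prop :=
  (form_norm r w < +oo)%E.

Definition Bform_oo k (w : dirac_chain U k -> R) : Prop := forall r, Bform r w.

(** Extension of w by continuity to the differential chain J. *)
Definition chain_int r k (J : Bhat ip U r k) (w : dirac_chain U k -> R) : R :=
  extend (w : dirac_chain U k -> R^o) J.

Definition chain_int_oo k (J : Bhat_oo ip U k) (w : dirac_chain U k -> R) : R :=
  chain_int (oo_repr J) w.

(** dw (p; v_1 /\ .. /\ v_(k+1)) = \sum_i (-1)^(i+1) D_(v_i) w (p; v_1 /\ .. ^v_i .. /\ v_(k+1))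
    for standard basis vectors v_i, extended linearly. *)
Definition ext_d k (w : dirac_chain U k -> R) : dirac_chain U k.+1 -> R :=
  fun A => \sum_(p \in supp A) \sum_(f : multi_index k.+1) A p f *
    \sum_(i < k.+1) (-1) ^+ i *
      'D_(row i (basis_mx f))
        (fun q => w (dirac_of U (dirac q (wedge (row' i (basis_mx f))))) : R^o) p.

Definition star m k (w : dirac_chain U k -> R) : dirac_chain U m -> R :=
  w \o @dirac_perp R n ip e U m k.

End Forms.

(* Main.v *)
From HB Require Import structures.
Require Import Defs.
From mathcomp Require Import all_boot all_order all_algebra.
From mathcomp Require Import fingroup perm sesquilinear.
From mathcomp Require Import all_classical all_reals all_analysis.
From mathcomp Require Import ring lra.
Import Order.TTheory GRing.Theory Num.Theory.
Import numFieldNormedType.Exports.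
Import Defs.
Local Open Scope classical_set_scope.
Local Open Scope ring_scope.
Set Implicit Arguments.
Unset Strict Implicit.
Unset Printing Implicit Defensive.

(** Both sides of the curl formula depend continuously on the chain J, so it is
    enough to compare them on Dirac chains.  On a Dirac chain (p; a), pairing
    P_v (p; a) with a form w gives the directional derivative along v at p of
    q |-> w (q; a) ([derive_dirac]).  Hence the integral of w over the boundary
    \sum_i P_(e_i) E_(e_i)^dagger (p; a) is a sum of derivatives along the e_i of
    w on contractions of a by the e_i.  The prederivative is linear in v, and a
    basis vector b is \sum_i <e_i, b> e_i, so the contractions recombine into the
    derivatives along the basis vectors that define dw ([contraction_sum],
    [boundary_dirac_int]).  Thus the integral of w over the boundary of K is that
    of dw over K ([chain_int_boundary]).  Taking for K the perpendicular complement
    of J gives the theorem, since the complement on chains is continuous and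
    restricts to the one on Dirac chains ([perp_continuous], [perp_embed]).  In the
    inductive limit, an integral does not depend on the order at which it is
    computed ([chain_int_oo_representative]).

    The rest of the work is to show that everything does extend continuously.

    - The mass is a norm equivalent to the coordinate norms: by the Cauchy-Binet
      formula the Gram determinant of k vectors is the sum of the squares of the
      minors of their coordinates in an orthonormal basis ([wedge_le_gram]).  So
      the exterior and interior products are bounded, and a form with finite norm
      is a bounded functional ([Bform_bounded]).

    - The limit defining P_v (p; a) exists in order 2: there, the path
      t |-> (p + t v; a) has second differences of norm at most a constant times
      |h| |s|, and such a path is differentiable ([almost_additive_cvg]).

    - P_v is bounded from order r to order r + 1 (at least 2), because applying
      Delta_(tv) to a term with j difference vectors gives one with j + 1 of them.
      The new term is inside U for small t since the convex hull of a finite set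
      is compact ([inside_delta_near]).

    - P_v is additive in v because Delta_(u+v) - Delta_u - Delta_v is the second
      difference Delta_v Delta_u, which is negligible in order 2
      ([dirac_P_direction_add]). *)

(** * Limits in normed modules *)

(** The limit rules below are stated for an abstract normed module so that they
    can be applied to spaces of chains without unfolding the completion. *)

Lemma continuous_at_dist (R : realType) (V W : normedModType R) (f : V -> W) p :
  (forall e, 0 < e -> exists2 d, 0 < d &
     forall q, `|p - q| < d -> `|f p - f q| < e) -> {for p, continuous f}.
Proof.
move=> fP; apply/cvgrPdist_lt => e /fP[d d0 dP].
by apply: filterS (nbhsx_ballx p _ d0) => q; rewrite -ball_normE/= => /dP.
Qed.

Lemma continuous_cvg_comp (R : realType) (V W : normedModType R) (T : Type)
    (F : set_system T) (f : T -> V) (g : V -> W) (l : V) :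
  continuous g -> f x @[x --> F] --> l -> g (f x) @[x --> F] --> g l.
Proof. by move=> gc fl; apply: (cvg_comp _ _ fl); exact: gc. Qed.

Lemma cvg_scaleD (R : realType) (V : normedModType R) (T : Type)
    (F : set_system T) {FF : Filter F} (c : R) (f g : T -> V) (l m : V) :
  f x @[x --> F] --> l -> g x @[x --> F] --> m ->
  c *: f x + g x @[x --> F] --> c *: l + m.
Proof. by move=> fl gm; apply: cvgD => //; exact: cvgZl_tmp. Qed.

Lemma near_cvg_eq (R : realType) (V : normedModType R) (T : Type)
    (F : set_system T) {FF : Filter F} (f g : T -> V) (l : V) :
  f x @[x --> F] --> l -> (\forall x \near F, f x = g x) -> g x @[x --> F] --> l.
Proof. by move=> fl fg; apply: cvg_trans fl; apply: near_eq_cvg. Qed.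

Lemma norm_cvg_unique (R : realType) (V : normedModType R) (T : Type)
    (F : set_system T) {FF : ProperFilter F} (f : T -> V) (l l' : V) :
  f x @[x --> F] --> l -> f x @[x --> F] --> l' -> l = l'.
Proof. exact: (cvg_unique (@norm_hausdorff _ _)). Qed.

Lemma norm_cvgD (R : realType) (V : normedModType R) (T : Type)
    (F : set_system T) {FF : Filter F} (f g : T -> V) (l m : V) :
  f x @[x --> F] --> l -> g x @[x --> F] --> m -> f x + g x @[x --> F] --> l + m.
Proof. by move=> fl gm; apply: cvgD. Qed.

Lemma cvg_scale (R : realType) (V : normedModType R) (T : Type)
    (F : set_system T) {FF : Filter F} (c : R) (f : T -> V) (l : V) :
  f x @[x --> F] --> l -> c *: f x @[x --> F] --> c *: l.
Proof. exact: cvgZl_tmp. Qed.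

Lemma norm_cvg_le (R : realType) (V : normedModType R) (T : Type)
    (F : set_system T) {FF : ProperFilter F} (f : T -> V) (l : V) (C : R) :
  f x @[x --> F] --> l -> (\forall x \near F, `|f x| <= C) -> `|l| <= C.
Proof. by move=> fl; apply: cvgr_to_le (cvg_norm fl). Qed.

Lemma norm_cvg_reindex (R : realType) (V : normedModType R) (S T : Type)
    (F : set_system S) (G : set_system T) (h : S -> T) (f : T -> V) (l : V) :
  h x @[x --> F] `=>` G -> f y @[y --> G] --> l -> f (h x) @[x --> F] --> l.
Proof. by move=> hG fl; exact: (cvg_comp _ _ hG fl). Qed.

Section AffineContinuous.
Context {R : realType} {V W : normedModType R} (f : V -> W).
Hypothesis fc : continuous f.

Lemma continuous_affine_comp (a : R) q : continuous (fun z => f (a *: z + q)).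
Proof.
move=> z; apply: (@continuous_comp _ _ _ (fun z => a *: z + q) f); last exact: fc.
by apply: cvgD; [exact: scaler_continuous|exact: cvg_cst].
Qed.

Lemma continuous_translation_comp q : continuous (fun z => f (q + z)).
Proof.
move=> z; apply: (@continuous_comp _ _ _ (fun z => q + z) f); last exact: fc.
by apply: cvgD; [exact: cvg_cst|].
Qed.

Lemma continuous_scale_comp (a : R) : continuous (fun z => a *: f z).
Proof. by move=> z; apply: cvgZl_tmp; exact: fc. Qed.

Lemma continuous_comp_affine (a : R) w : continuous (fun z => a *: f z + w).
Proof. by move=> z; apply: cvgD; [apply: cvgZl_tmp; exact: fc|exact: cvg_cst]. Qed.

Lemma continuous_comp_translation w : continuous (fun z => w + f z).
Proof. by move=> z; apply: cvgD; [exact: cvg_cst|exact: fc]. Qed.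

End AffineContinuous.

(** * Extension of bounded linear maps by continuity *)
Section BoundedExtension.
Context {R : realType} {V : lmodType R} (N : seminorm V).
Implicit Types (p q : completion N) (x : V).

(** An extension is a limit along the traces of the neighbourhoods of [p], so every
    continuous map that restricts to [f] computes it; [f] itself may be any map. *)
Lemma extend_continuous (W : normedModType R) (f : V -> W)
    (g : completion N -> W) p :
  {for p, continuous g} -> (forall x, g (embed N x) = f x) -> extend f p = g p.
Proof.
move=> gc gf; apply: cvg_lim; first exact: norm_hausdorff.
rewrite (_ : f = g \o embed N); last by apply/funext => x /=; rewrite gf.
exact: cvg_trans (cvg_app g (@embed_nbhs_cvg _ _ _ p)) gc.
Qed.

Lemma eq_on_embed (W : normedModType R) (g h : completion N -> W) :
  continuous g -> continuous h ->
  (forall x, g (embed N x) = h (embed N x)) -> g =1 h.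
Proof.
move=> gc hc gh p.
have gE := extend_continuous (f := g \o embed N) (gc p).
have hE := extend_continuous (f := g \o embed N) (hc p).
by rewrite -gE// hE// => x; rewrite /= gh.
Qed.

Context {W : completeNormedModType R}.

(** Both sides of the linearity equation are continuous in each variable, so density
    is used once for [p] and once for [q]. *)
Let extend_contraction (f : {linear V -> W}) :
  (forall x, `|f x| <= N x) ->
  linear (extend f : completion N -> W) /\
  continuous (extend f : completion N -> W).
Proof.
move=> f1.
have ec : continuous (extend f : completion N -> W).
  move=> p; apply: continuous_at_dist => e e0.
  have e4 : 0 < e / 4 by rewrite divr_gt0.
  have [x px] := embed_dense p e4.
  exists (e / 4) => // q pq.
  rewrite -(subrKA (f x)) (le_lt_trans (ler_normD _ _))//.
  apply: (@le_lt_trans _ _ (`|p - embed N x| + `|q - embed N x|)).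
    by rewrite lerD ?[`|f x - _|]distrC ?extend_bound.
  have : `|q - embed N x| <= `|p - q| + `|p - embed N x|.
    by rewrite (distrC p q) -[q - embed N x](subrKA p) ler_normD.
  lra.
split=> // a p q.
apply: (@eq_on_embed W (fun z => extend f (a *: z + q))
  (fun z => a *: extend f z + extend f q)) p => //.
- exact: continuous_affine_comp.
- exact: continuous_comp_affine.
move=> x; apply: (@eq_on_embed W (fun z => extend f (a *: embed N x + z))
  (fun z => a *: extend f (embed N x) + extend f z)) q => //.
- exact: continuous_translation_comp.
- exact: continuous_comp_translation.
by move=> y; rewrite -linearP !extend_embed// linearP.
Unshelve. all: by end_near. Qed.

(** Dividing [f] by a positive bound makes it a contraction, which maps the traces of
    neighbourhoods to Cauchy filters. *)
Lemma extend_bounded (f : V -> W) (C : R) :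
  linear f -> (forall x, `|f x| <= C * N x) ->
  [/\ linear (extend f : completion N -> W),
      continuous (extend f : completion N -> W) &
      forall x, extend f (embed N x) = f x].
Proof.
move=> lf fC.
pose D := `|C| + 1.
have D0 : 0 < D by rewrite ltr_wpDl.
have lg : linear (fun x => D^-1 *: f x).
  by move=> a x y; rewrite lf scalerDr !scalerA mulrC.
pose g : {linear V -> W} := HB.pack (fun x => D^-1 *: f x)
  (GRing.isLinear.Build R V W _ _ lg).
have g1 x : `|g x| <= N x.
  rewrite /= normrZ gtr0_norm ?invr_gt0// ler_pdivrMl//.
  apply: (le_trans (fC x)); rewrite ler_wpM2r ?snorm_ge0//.
  by rewrite (le_trans (ler_norm C))// lerDl.
have [lE cE] := extend_contraction g1.
have cDE : continuous (fun p : completion N => D *: extend g p).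
  exact: continuous_scale_comp.
have DE x : D *: extend g (embed N x) = f x.
  by rewrite extend_embed//= scalerA divff ?scale1r// lt0r_neq0.
have -> : extend f = (fun p : completion N => D *: extend g p).
  by apply/funext => p; exact: (extend_continuous (cDE p) DE).
split=> // a p q.
by rewrite lE scalerDr !scalerA mulrC.
Qed.

End BoundedExtension.

(** * The Cauchy-Binet formula and the mass of multivectors *)

Section CauchyBinet.
Context {R : comNzRingType} {k n : nat}.
Implicit Types (B : 'M[R]_(k, n)) (D : 'M[R]_(n, k)) (g : {ffun 'I_k -> 'I_n}).

Lemma det_mulmx_sum B D :
  \det (B *m D) = \sum_(g : {ffun 'I_k -> 'I_n}) (\prod_i B i (g i)) * \det (rowsub g D).
Proof.
pose BD (s : 'S_k) i j := B i j * D j (s i).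
transitivity (\sum_(g : {ffun 'I_k -> 'I_n}) \sum_(s : 'S_k)
    (-1) ^+ s * \prod_i BD s i (g i)).
  rewrite exchange_big; apply: eq_bigr => /= s _; rewrite -big_distrr /=.
  congr (_ * _); rewrite -(bigA_distr_bigA (BD s)) /=.
  by apply: eq_bigr => x _; rewrite mxE.
apply: eq_bigr => g _; rewrite big_distrr/=; apply: eq_bigr => s _.
rewrite mulrCA big_split/=; congr (_ * (_ * _)).
by apply: eq_bigr => i _; rewrite mxE.
Qed.

(** Summing over all maps, and not only increasing ones, repeats each term of the usual
    formula k! times.  Expand the first minor over permutations [s]: composing [g]
    with [s] multiplies the second minor by the sign of [s], so that every [s]
    contributes the expansion [det_mulmx_sum] of the left-hand determinant. *)
Lemma Cauchy_Binet B D :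
  \det (B *m D) *+ k`! =
  \sum_(g : {ffun 'I_k -> 'I_n}) \det (colsub g B) * \det (rowsub g D).
Proof.
pose T (h : {ffun 'I_k -> 'I_n}) := (\prod_i B i (h i)) * \det (rowsub h D).
pose c (s : 'S_k) g : {ffun 'I_k -> 'I_n} := [ffun i => g (s i)].
have cK s : cancel (c s) (c s^-1%g).
  by move=> g; apply/ffunP => i; rewrite !ffunE permKV.
transitivity (\sum_(g : {ffun 'I_k -> 'I_n}) \sum_(s : 'S_k) T (c s g)).
  rewrite exchange_big/= (eq_bigr (fun=> \sum_g T g)) => [|s _]; last first.
    by rewrite [RHS](reindex_inj (can_inj (cK s))).
  by rewrite -det_mulmx_sum sumr_const card_Sn.
apply: eq_bigr => g _; rewrite big_distrl/=; apply: eq_bigr => s _.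
rewrite /T (_ : rowsub (c s g) D = row_perm s (rowsub g D)); last first.
  by apply/matrixP => i j; rewrite !mxE ffunE.
rewrite row_permE det_mulmx det_perm mulrA [_ * (-1) ^+ s]mulrC.
by congr (_ * _ * _); apply: eq_bigr => i _; rewrite mxE ffunE.
Qed.

End CauchyBinet.

Section MultiIndexBasis.
Context {R : realType} {n : nat}.
Implicit Types (k : nat).

Lemma multi_index_ltn k (f : @multi_index n k) (i j : 'I_k) :
  (i < j)%N -> (val f i < val f j)%N.
Proof. by case: f => f /= /forallP/(_ i)/forallP/(_ j)/implyP. Qed.

Lemma multi_index_inj k (f : @multi_index n k) : injective (val f).
Proof.
move=> i j fij; apply: val_inj; apply/eqP.
by case: ltngtP => // /(multi_index_ltn f); rewrite fij ltnn.
Qed.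

(** An increasing tuple is determined by its range, and ranges of equal size that are
    nested coincide. *)
Lemma multi_index_sub k (f g : @multi_index n k) :
  (forall i, exists j, val f i = val g j) -> f = g.
Proof.
move=> fg.
pose s (h : @multi_index n k) := [seq nat_of_ord (val h i) | i <- enum 'I_k].
have s_sorted h : sorted ltn (s h).
  apply: (homo_sorted (e := fun i j : 'I_k => (i < j)%N)).
    exact: multi_index_ltn.
  have := iota_ltn_sorted 0 k.
  by rewrite -val_enum_ord sorted_map.
have s_uniq h : uniq (s h) by exact: sorted_uniq ltn_trans ltnn _ (s_sorted h).
have sub : {subset s f <= s g}.
  move=> _ /mapP[i _ ->]; have [j ->] := fg i.
  by apply: map_f; rewrite mem_enum.
have sfg : s f = s g.
  apply: (irr_sorted_eq ltn_trans ltnn) => //.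
  have ss : (size (s g) <= size (s f))%N by rewrite !size_map.
  by case: (uniq_min_size (s_uniq f) sub ss).
have nthE h (i : 'I_k) : nth 0%N (s h) i = val h i.
  by rewrite (nth_map i) ?size_enum_ord// nth_ord_enum.
apply: val_inj; apply/ffunP => i; apply: val_inj => /=.
by rewrite -!nthE sfg.
Qed.

(** For distinct multi-indices the minor has a zero row. *)
Lemma wedge_basis k (f g : @multi_index n k) :
  wedge (basis_mx f : 'M[R]_(k, n)) g = (f == g)%:R.
Proof.
rewrite ffunE; case: eqP => [->|fg].
  rewrite (_ : colsub _ _ = 1%:M) ?det1//; apply/matrixP => i j.
  by rewrite !mxE (inj_eq (@multi_index_inj _ g)).
have [i iP] : exists i, forall j, val f i != val g j.
  apply: contrapT => /forallNP H; apply: fg; apply: multi_index_sub => i.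
  by have /existsNP[j /negP/negPn/eqP ij] := H i; exists j.
rewrite (expand_det_row _ i) big1// => j _.
by rewrite !mxE (negbTE (iP j)) mul0r.
Qed.

Lemma ext_basis k (a : ext R n k) : a = \sum_f a f *: wedge (basis_mx f).
Proof.
apply/ffunP => g; rewrite sum_ffunE (bigD1 g)//= big1 => [|f fg].
  by rewrite addr0 ffunE wedge_basis eqxx; exact/esym/mulr1.
by rewrite ffunE wedge_basis (negbTE fg); exact: mulr0.
Qed.

End MultiIndexBasis.

Section Orthonormal.
Context {R : realType} {n : nat} (ip : {dot 'rV[R]_n for idfun}).

Lemma ip_sym u v : ip u v = ip v u.
Proof. by rewrite hermC expr0 mul1r. Qed.

Lemma ipZl c u v : ip (c *: u) v = c * ip u v.
Proof. exact: linearZl_LR. Qed.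

Lemma vnormZ c u : vnorm ip (c *: u) = `|c| * vnorm ip u.
Proof.
rewrite /vnorm ipZl ip_sym ipZl mulrA -expr2 sqrtrM ?sqr_ge0//.
by rewrite sqrtr_sqr.
Qed.

Lemma vnorm_eq0 u : vnorm ip u = 0 -> u = 0.
Proof.
move=> /eqP u0; apply: contrapT => /eqP /(neq0_dnorm_gt0 (s := ip)) ugt0.
by move: u0; rewrite sqrtr_eq0 leNgt ugt0.
Qed.

Context (e : 'I_n -> 'rV[R]_n).
Hypothesis e_orthonormal : forall i j : 'I_n, ip (e i) (e j) = (i == j)%:R.

Lemma ip_coord (c : 'I_n -> R) i : ip (e i) (\sum_j c j *: e j) = c i.
Proof.
rewrite linear_sumr (bigD1 i)//= linearZr_LR/= e_orthonormal eqxx mulr1.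
rewrite big1 ?addr0// => j ji.
by rewrite linearZr_LR/= e_orthonormal eq_sym (negbTE ji) mulr0.
Qed.

Lemma orthonormal_expansion v : v = \sum_i ip (e i) v *: e i.
Proof.
pose E : 'M[R]_n := \matrix_i e i.
have mulE (u : 'rV[R]_n) : u *m E = \sum_i u 0 i *: e i.
  by rewrite mulmx_sum_row; apply: eq_bigr => i _; rewrite rowK.
have Eu : E \in unitmx.
  rewrite -row_free_unit; apply: inj_row_free => u uE0.
  apply/rowP => i; rewrite -(ip_coord (fun i => u 0 i)) -mulE uE0.
  by rewrite linear0r mxE.
rewrite -[v in LHS](mulmxKV Eu) mulE; apply: eq_bigr => i _; congr (_ *: _).
by rewrite -[v in RHS](mulmxKV Eu) mulE ip_coord.
Qed.

Lemma ip_expansion u v : ip u v = \sum_i ip u (e i) * ip v (e i).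
Proof.
rewrite [v in LHS]orthonormal_expansion linear_sumr; apply: eq_bigr => i _.
by rewrite linearZr_LR/= mulrC ip_sym (ip_sym v) ip_sym.
Qed.

(** Let B be the coordinates of the rows of A in the orthonormal basis.  The Gram matrix
    is B B^T, so by Cauchy-Binet the Gram determinant is, up to the factor k!, the sum
    of the squares of the minors of B and dominates each of them.  The minors of
    A = B E are, again by Cauchy-Binet, fixed combinations of those of B. *)
Lemma wedge_le_gram k : exists2 C : R, 0 < C &
  forall (A : 'M[R]_(k, n)) f, `|wedge A f| <= C * Num.sqrt (gram ip A).
Proof.
pose E : 'M[R]_n := \matrix_i e i.
pose M (f : multi_index k) (g : {ffun 'I_k -> 'I_n}) : R :=
  \det (rowsub g (colsub (val f) E)).
pose K : R := k`!%:R.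
have K1 : 1 <= K by rewrite ler1n fact_gt0.
have K0 : 0 < K by exact: lt_le_trans K1.
(* The summand 1 only serves to make the constant positive. *)
exists (1 + Num.sqrt K * \sum_f \sum_g `|M f g|).
  by rewrite ltr_wpDr// mulr_ge0 ?sqrtr_ge0// sumr_ge0// => f _; rewrite sumr_ge0.
move=> A f; pose B : 'M[R]_(k, n) := \matrix_(i, j) ip (row i A) (e j).
have gramE : gram ip A * K = \sum_(g : {ffun 'I_k -> 'I_n}) \det (colsub g B) ^+ 2.
  rewrite mulr_natr (_ : gram ip A = \det (B *m B^T)).
    rewrite Cauchy_Binet; apply: eq_bigr => g _.
    by rewrite expr2 -[X in _ * X = _]det_tr trmx_mxsub trmxK.
  congr (\det _); apply/matrixP => i j; rewrite !mxE ip_expansion.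
  by apply: eq_bigr => l _; rewrite !mxE.
have AE : A = B *m E.
  apply/row_matrixP => i; rewrite row_mul [LHS]orthonormal_expansion.
  rewrite mulmx_sum_row; apply: eq_bigr => j _.
  by rewrite rowK !mxE ip_sym.
have BK g : `|\det (colsub g B)| <= Num.sqrt K * Num.sqrt (gram ip A).
  rewrite -sqrtrM ?(ltW K0)// -sqrtr_sqr ler_sqrt; last first.
    by rewrite mulrC gramE sumr_ge0// => h _; rewrite sqr_ge0.
  rewrite mulrC gramE (bigD1 [ffun i => g i])//=.
  rewrite (_ : colsub [ffun i => g i] B = colsub g B).
    by rewrite lerDl sumr_ge0// => h _; rewrite sqr_ge0.
  by apply/matrixP => i j; rewrite !mxE ffunE.
rewrite mulrDl mul1r; apply: ler_wpDl; first exact: sqrtr_ge0.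
apply: (@le_trans _ _ (`|wedge A f| * K)); first by rewrite ler_peMr.
rewrite -[K in leLHS]gtr0_norm// -normrM mulr_natr ffunE {1}AE.
rewrite (_ : colsub _ _ = B *m colsub (val f) E); last first.
  by apply/matrixP => i j; rewrite !mxE; apply: eq_bigr => l _; rewrite !mxE.
rewrite Cauchy_Binet (le_trans (ler_norm_sum _ _ _))//.
rewrite mulrAC mulr_sumr (bigD1 f)//= -[leLHS]addr0 lerD//; last first.
  rewrite sumr_ge0// => h _; rewrite mulr_ge0// ?mulr_ge0 ?sqrtr_ge0//.
  by rewrite sumr_ge0.
by rewrite mulr_sumr ler_sum// => g _; rewrite normrM ler_wpM2r.
Qed.

Lemma mass_sum_le k (I : Type) (s : seq I) (c : I -> R) (A : I -> 'M[R]_(k, n)) :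
  mass ip (\sum_(i <- s) c i *: wedge (A i)) <=
  \sum_(i <- s) `|c i| * Num.sqrt (gram ip (A i)).
Proof.
apply: ge_inf.
  by exists 0 => _ [l _ ->]; apply: sumr_ge0 => t _; rewrite mulr_ge0 ?sqrtr_ge0.
by exists [seq (c i, A i) | i <- s]; rewrite big_map.
Qed.

(** The mass is an infimum over decompositions into simple vectors, on each of which
    [wedge_le_gram] applies; that there is a decomposition at all is [ext_basis]. *)
Lemma coord_le_mass k : exists2 C : R, 0 < C &
  forall (a : ext R n k) f, `|a f| <= C * mass ip a.
Proof.
have [C C0 CP] := wedge_le_gram k; exists C => // a f.
rewrite -ler_pdivrMl// lb_le_inf//.
  exists (\sum_(t <- [seq (a g, basis_mx g) | g <- index_enum (multi_index k)])
    `|t.1| * Num.sqrt (gram ip t.2)).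
  by eexists; [|reflexivity]; rewrite big_map -ext_basis.
move=> _ [l al ->]; rewrite ler_pdivrMl// al sum_ffunE.
rewrite (le_trans (ler_norm_sum _ _ _))// mulr_sumr ler_sum// => t _.
by rewrite ffunE normrM mulrCA ler_wpM2l.
Qed.

Lemma mass_eq0 k (a : ext R n k) : mass ip a = 0 -> a = 0.
Proof.
have [C C0 CP] := coord_le_mass k => a0; apply/ffunP => f.
by have := CP a f; rewrite a0 mulr0 normr_le0 ffunE => /eqP.
Qed.

(** Expanded on the basis, the product is a sum of simple vectors whose coefficients are
    coordinates of [a], hence bounded by its mass. *)
Lemma ext_mul_mass k v : exists2 C : R, 0 <= C &
  forall a : ext R n k, mass ip (ext_mul v a) <= C * mass ip a.
Proof.
have [C C0 CP] := coord_le_mass k.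
exists (\sum_(f : multi_index k) C * Num.sqrt (gram ip (col_mx v (basis_mx f)))).
  by rewrite sumr_ge0// => f _; rewrite mulr_ge0 ?sqrtr_ge0 ?(ltW C0).
move=> a; rewrite (le_trans (mass_sum_le _ _ _))// mulr_suml ler_sum// => f _.
by rewrite mulrAC ler_wpM2r ?sqrtr_ge0.
Qed.

Lemma ext_int_mass k v : exists2 C : R, 0 <= C &
  forall a : ext R n k.+1, mass ip (ext_int ip v a) <= C * mass ip a.
Proof.
have [C C0 CP] := coord_le_mass k.+1.
pose c (f : multi_index k.+1) (i : 'I_k.+1) : R :=
  (-1) ^+ i * ip v (row i (basis_mx f)).
pose A (f : multi_index k.+1) (i : 'I_k.+1) : 'M[R]_(k, n) := row' i (basis_mx f).
exists (\sum_f \sum_i C * (`|c f i| * Num.sqrt (gram ip (A f i)))).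
  rewrite sumr_ge0// => f _; rewrite sumr_ge0// => i _.
  by rewrite mulr_ge0 ?(ltW C0)// mulr_ge0 ?sqrtr_ge0.
move=> a; have -> : ext_int ip v a =
    \sum_(t <- index_enum (multi_index k.+1 * 'I_k.+1)%type)
      (a t.1 * c t.1 t.2) *: wedge (A t.1 t.2).
  rewrite -(pair_bigA _ (fun f i => (a f * c f i) *: wedge (A f i)))/=.
  apply: eq_bigr => f _; rewrite scaler_sumr; apply: eq_bigr => i _.
  by rewrite scalerA.
rewrite (le_trans (mass_sum_le _ _ _))//.
rewrite -(pair_bigA _ (fun f i => `|a f * c f i| * Num.sqrt (gram ip (A f i))))/=.
rewrite mulr_suml ler_sum// => f _; rewrite mulr_suml ler_sum// => i _.
by rewrite normrM -[leLHS]mulrA [leRHS]mulrAC ler_wpM2r// mulr_ge0 ?sqrtr_ge0.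
Qed.

End Orthonormal.

Section ExteriorOperators.
Context {R : realType} {n : nat} (ip : 'rV[R]_n -> 'rV[R]_n -> R).

Lemma sum_coord_linear k (W : lmodType R) (b : multi_index k -> W) :
  linear (fun a : ext R n k => \sum_f a f *: b f).
Proof.
move=> c a a'; rewrite scaler_sumr -big_split/=; apply: eq_bigr => f _.
by rewrite !ffunE scalerDl scalerA.
Qed.

Lemma ext_mul_linear k v : linear (@ext_mul R n k v).
Proof. exact: sum_coord_linear. Qed.

Lemma ext_int_linear k v : linear (@ext_int R n ip k v).
Proof. exact: sum_coord_linear. Qed.

End ExteriorOperators.

(** * Dirac chains and the chain norms *)

Section DiracChainLemmas.
Context {R : realType} {n : nat}.
Implicit Types (U : set 'rV[R]_n) (k : nat) (u v p q : 'rV[R]_n).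

Lemma delta0 k u : delta u (0 : 'rV[R]_n -> ext R n k) = 0.
Proof. by apply/funext => q; rewrite /delta/translate/= subrr. Qed.

Lemma delta_linear k u : linear (@delta R n k u).
Proof.
move=> c A B; apply/funext => q; rewrite /delta/translate.
by rewrite -[LHS]/(c *: A (q - u) + B (q - u) - (c *: A q + B q))
  -[RHS]/(c *: (A (q - u) - A q) + (B (q - u) - B q)) scalerBr opprD addrACA.
Qed.

Lemma deltas0 k s : deltas s (0 : 'rV[R]_n -> ext R n k) = 0.
Proof. by elim: s => //= u s IH; rewrite delta0. Qed.

Lemma deltas_rcons k s u (A : 'rV[R]_n -> ext R n k) :
  deltas (rcons s u) A = delta u (deltas s A).
Proof. by rewrite /deltas -cats1 foldl_cat. Qed.

Lemma delta_vec0 k (A : 'rV[R]_n -> ext R n k) : delta 0 A = 0.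
Proof. by apply/funext => q; rewrite -[LHS]/(A (q - 0) - A q) subr0 subrr. Qed.

Lemma deltas_vec0 k s (A : 'rV[R]_n -> ext R n k) : 0 \in s -> deltas s A = 0.
Proof.
elim: s A => //= u s IH A; rewrite inE => /predU1P[<-|/IH//].
by rewrite -/(deltas _ _) delta_vec0 deltas0.
Qed.

Lemma dirac0 k p : dirac p (0 : ext R n k) = 0.
Proof. by apply/funext => q; rewrite /dirac if_same. Qed.

Lemma supp_delta k u (A : 'rV[R]_n -> ext R n k) :
  supp (delta u A) `<=` supp A `|` [set p + u | p in supp A].
Proof.
move=> q /=; rewrite /supp/=/delta/translate => qA.
have [Aq|Aq] := eqVneq (A q) 0; last by left.
right; exists (q - u); last by rewrite subrK.
apply: contra_neq qA => Aqu.
by rewrite -[LHS]/(A (q - u) - A q) Aqu Aq subrr.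
Qed.

Lemma supp_dirac k p (a : ext R n k) : supp (dirac p a) `<=` [set p].
Proof. by move=> q; rewrite /supp/dirac/=; case: (q =P p) => //; rewrite eqxx. Qed.

Lemma finite_supp_delta k u (A : 'rV[R]_n -> ext R n k) :
  finite_set (supp A) -> finite_set (supp (delta u A)).
Proof.
move=> fA; apply: sub_finite_set (@supp_delta _ u A) _.
by rewrite finite_setU; split=> //; exact: finite_image.
Qed.

Lemma finite_supp_dirac k p (a : ext R n k) : finite_set (supp (dirac p a)).
Proof. exact: sub_finite_set (@supp_dirac _ p a) (finite_set1 p). Qed.

Lemma finite_supp_deltas k s (A : 'rV[R]_n -> ext R n k) :
  finite_set (supp A) -> finite_set (supp (deltas s A)).
Proof. by elim: s A => //= u s IH A fA; exact/IH/finite_supp_delta. Qed.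

Lemma finite_supp_dterm k (t : @dterm R n k) : finite_set (supp (dterm_chain t)).
Proof. exact/finite_supp_deltas/finite_supp_dirac. Qed.

Lemma sub_convex_hull (S : set 'rV[R]_n) : S `<=` convex_hull S.
Proof. by move=> p Sp C [_]; exact. Qed.

Lemma inside_dirac_pred U k (A : 'rV[R]_n -> ext R n k) :
  finite_set (supp A) -> inside U A -> A \in dirac_pred U (k := k).
Proof.
move=> fA iA; apply/asboolP; split=> // p /sub_convex_hull; exact: iA.
Qed.

Lemma dterm_dirac_pred U k (t : @dterm R n k) :
  inside U (dterm_chain t) -> dterm_chain t \in dirac_pred U (k := k).
Proof. by apply: inside_dirac_pred; exact: finite_supp_dterm. Qed.

Lemma dirac_ofK U k (A : 'rV[R]_n -> ext R n k) :
  A \in dirac_pred U (k := k) -> dirac_of U A = A :> (_ -> _).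
Proof. exact: insubdK. Qed.

Lemma dirac_fun_sum U k (I : Type) (s : seq I) (F : I -> dirac_chain U k) :
  \sum_(i <- s) F i = \sum_(i <- s) (F i : _ -> _) :> ('rV[R]_n -> ext R n k).
Proof. by elim/big_rec2: _ => // i A B _ <-. Qed.

Lemma dirac_of_fun U k (A : dirac_chain U k) : dirac_of U A = A.
Proof. exact: valKd. Qed.

End DiracChainLemmas.

Section ChainNorm.
Context {R : realType} {n : nat} (ip : 'rV[R]_n -> 'rV[R]_n -> R).
Context (U : set 'rV[R]_n).
Implicit Types (r k : nat).

Lemma Bnorm_le_masses r k (A : dirac_chain U k) (l : seq (@dterm R n k)) :
  decomposition U r A l -> Bnorm ip r A <= \sum_(t <- l) dterm_mass ip t.
Proof.
by move=> Al; apply: (ge_inf (decomposition_masses_lb _ _ _ _)); exists l.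
Qed.

Lemma Bnorm_dterm r k (t : @dterm R n k) :
  (size t.1.1 <= r)%N -> inside U (dterm_chain t) ->
  Bnorm ip r (dirac_of U (dterm_chain t)) <= dterm_mass ip t.
Proof.
move=> tr tU; have <- : \sum_(t <- [:: t]) dterm_mass ip t = dterm_mass ip t.
  by rewrite big_seq1.
apply: Bnorm_le_masses; split.
- by rewrite big_seq1 dirac_ofK// dterm_dirac_pred.
- by move=> t'; rewrite inE => /eqP ->.
- by move=> t'; rewrite inE => /eqP ->.
Qed.

Lemma decomposition_dirac_of r k (A : dirac_chain U k) (l : seq (@dterm R n k)) :
  decomposition U r A l -> A = \sum_(t <- l) dirac_of U (dterm_chain t).
Proof.
move=> [Al _ lU]; apply: val_inj; rewrite /= dirac_fun_sum Al big_seq [RHS]big_seq.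
by apply: eq_bigr => t /lU tU; rewrite dirac_ofK// dterm_dirac_pred.
Qed.

(** The chain norm is an infimum over decompositions into terms, so linear maps are
    bounded as soon as they are bounded on single terms. *)
Lemma bounded_on_dterms (W : normedModType R) r k (f : dirac_chain U k -> W) (C : R) :
  0 <= C -> linear f ->
  (forall t : @dterm R n k, (size t.1.1 <= r)%N -> inside U (dterm_chain t) ->
     `|f (dirac_of U (dterm_chain t))| <= C * dterm_mass ip t) ->
  forall A, `|f A| <= C * Bnorm ip r A.
Proof.
move=> C0 lf fC A.
pose F : {linear dirac_chain U k -> W} :=
  HB.pack f (GRing.isLinear.Build R _ W _ f lf).
apply/ler_addgt0Pr => d d0.
(* After scaling by C, a distance d / (C + 1) to the infimum becomes at most d. *)
have C1 : 0 < C + 1 by rewrite ltr_wpDl.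
have [_ [l Al ->] lA] := inf_adherent (divr_gt0 d0 C1)
  (conj (decomposition_masses_neq0 ip r A) (decomposition_masses_lb ip U r A)).
apply: (@le_trans _ _ (C * \sum_(t <- l) dterm_mass ip t)); last first.
  apply: (@le_trans _ _ (C * (Bnorm ip r A + d / (C + 1)))).
    by rewrite ler_wpM2l// ltW.
  rewrite mulrDr lerD2l mulrCA -[leRHS]mulr1 ler_wpM2l ?(ltW d0)//.
  by rewrite ler_pdivrMr// mul1r lerDl.
rewrite (decomposition_dirac_of Al) -[f _]/(F _) linear_sum.
rewrite (le_trans (ler_norm_sum _ _ _))// mulr_sumr big_seq [leRHS]big_seq.
by case: Al => _ lr lU; apply: ler_sum => t tl; apply: fC; [exact: lr|exact: lU].
Qed.

Lemma Bembed_norm r k (A : dirac_chain U k) : `|Bembed ip r A| = Bnorm ip r A.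
Proof. exact: embed_norm. Qed.

Lemma Bembed_linear r k : linear (@Bembed R n ip U r k).
Proof. exact: linearP. Qed.

Lemma Bembed0 r k : Bembed ip r (0 : dirac_chain U k) = 0.
Proof. exact: linear0. Qed.

Lemma BembedD r k (A B : dirac_chain U k) :
  Bembed ip r (A + B) = Bembed ip r A + Bembed ip r B.
Proof. exact: linearD. Qed.

Lemma BembedZ r k c (A : dirac_chain U k) :
  Bembed ip r (c *: A) = c *: Bembed ip r A.
Proof. exact: linearZ. Qed.

Lemma dirac_map_linear k m (g : ext R n k -> ext R n m) (g0 : g 0 = 0) :
  linear g -> linear (dirac_map (U := U) g0).
Proof.
by move=> lg c A B; apply: val_inj; apply/funext => p; exact: lg.
Qed.

Lemma deltas_map k m (g : ext R n k -> ext R n m) s p (a : ext R n k) :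
  linear g -> g \o deltas s (dirac p a) = deltas s (dirac p (g a)).
Proof.
move=> lg.
pose G : {linear ext R n k -> ext R n m} :=
  HB.pack g (GRing.isLinear.Build R _ (ext R n m) _ g lg).
have gD u A : g \o delta u A = delta u (g \o A).
  by apply/funext => q /=; exact: (raddfB G).
have -> : dirac p (g a) = g \o dirac p a.
  apply/funext => q /=; rewrite /dirac; case: ifP => // _.
  exact/esym/(raddf0 G).
by elim: s (dirac p a) => //= u s IH A; rewrite IH gD.
Qed.

Lemma inside_map k m (g : ext R n k -> ext R n m) A :
  g 0 = 0 -> inside U A -> inside U (g \o A).
Proof.
move=> g0 AU p pA; apply: AU => C [cC AC]; apply: pA; split=> // q qA.
by apply: AC; apply: contra_neq qA => /= ->.
Qed.

(** A pointwise linear map commutes with translations, so it turns a term into a term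
    with the same difference vectors. *)
Lemma dirac_map_bounded r k m (g : ext R n k -> ext R n m) (g0 : g 0 = 0) (C : R) :
  linear g -> 0 <= C -> (forall a, mass ip (g a) <= C * mass ip a) ->
  forall A : dirac_chain U k, `|Bembed ip r (dirac_map g0 A)| <= C * Bnorm ip r A.
Proof.
move=> lg C0 gC; apply: bounded_on_dterms => //.
  by move=> c A B; rewrite dirac_map_linear// Bembed_linear.
move=> t tr tU; have tU' : inside U (dterm_chain (t.1, g t.2)).
  by rewrite /dterm_chain/= -deltas_map//; exact: inside_map.
rewrite (_ : dirac_map _ _ = dirac_of U (dterm_chain (t.1, g t.2))); last first.
  apply: val_inj; rewrite /= !dirac_ofK ?dterm_dirac_pred//.
  exact: deltas_map.
rewrite Bembed_norm (le_trans (Bnorm_dterm _ _))//.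
rewrite /dterm_mass/= mulrCA ler_wpM2l// prodr_ge0// => u _.
exact: sqrtr_ge0.
Qed.

End ChainNorm.

Section BoundedForms.
Context {R : realType} {n : nat} (ip : {dot 'rV[R]_n for idfun}).
Context (e : 'I_n -> 'rV[R]_n).
Hypothesis e_orthonormal : forall i j : 'I_n, ip (e i) (e j) = (i == j)%:R.
Context (U : set 'rV[R]_n).

Lemma dterm_mass_ge0 k (t : @dterm R n k) : 0 <= dterm_mass ip t.
Proof.
rewrite mulr_ge0 ?mass_ge0// prodr_ge0// => u _; exact: sqrtr_ge0.
Qed.

(** Either some difference vector is zero or the k-vector is.  These are the terms that
    cannot be rescaled to mass one in [Bform_bounded]. *)
Lemma dterm_mass_eq0 k (t : @dterm R n k) : dterm_mass ip t = 0 -> dterm_chain t = 0.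
Proof.
move=> /eqP; rewrite mulf_eq0 => /orP[|/eqP/(mass_eq0 e_orthonormal) t0].
  rewrite prodf_seq_eq0 => /hasP[u ut /= /eqP/vnorm_eq0 u0].
  by rewrite /dterm_chain deltas_vec0// -u0.
by rewrite /dterm_chain t0 dirac0 deltas0.
Qed.

Lemma massZ_eq k c (a : ext R n k) : c != 0 -> mass ip (c *: a) = `|c| * mass ip a.
Proof.
move=> c0; apply/eqP; rewrite eq_le massZ/= -ler_pdivlMl ?normr_gt0//.
rewrite -normfV (le_trans _ (massZ _ _ _))// scalerA mulVf// scale1r.
exact: lexx.
Qed.

(** The form norm only sees terms of mass one; a term of mass m > 0 is divided by m. *)
Lemma Bform_bounded r k (w : {linear dirac_chain U k -> R^o}) :
  Bform ip r w -> exists2 C : R, 0 <= C & forall A, `|w A| <= C * Bnorm ip r A.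
Proof.
rewrite /Bform; move wE : (form_norm _ _ _) => N Noo.
have N0 : (0 <= N)%E by rewrite -wE; exact: bigmax_ge_id.
have Nfin : N \is a fin_num by rewrite ge0_fin_numE.
exists (fine N); first exact: fine_ge0.
apply: bounded_on_dterms; [exact: fine_ge0|exact: linearP|].
move=> t tr tU; have [m0|m0] := eqVneq (dterm_mass ip t) 0.
  rewrite m0 mulr0 dterm_mass_eq0// (_ : dirac_of U 0 = 0) ?linear0 ?normr0//.
  exact: (dirac_of_fun 0).
have mgt0 : 0 < dterm_mass ip t by rewrite lt_neqAle eq_sym m0 dterm_mass_ge0.
pose c := (dterm_mass ip t)^-1.
have c0 : 0 < c by rewrite invr_gt0.
pose t' : @dterm R n k := (t.1, c *: t.2).
have t'E : dterm_chain t' = c *: dterm_chain t.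
  by rewrite /dterm_chain/= diracZ deltasZ.
have t'U : inside U (dterm_chain t') by rewrite t'E; exact: insideZ.
have wt' : w (dirac_of U (dterm_chain t')) = c *: w (dirac_of U (dterm_chain t)).
  rewrite -linearZ/=; congr (w _); apply: val_inj.
  by rewrite /= !dirac_ofK ?dterm_dirac_pred.
rewrite -ler_pdivrMr// -/c mulrC -[c]gtr0_norm// -normrM -lee_fin fineK//.
rewrite -[c * _]/(c *: _) -wt' -wE.
have tr1 : (size t.1.1 < r.+1)%N by [].
apply: le_trans (le_bigmax _ _ (Ordinal tr1)).
apply: ereal_sup_ubound; exists t'; split=> //.
by rewrite /dterm_mass/= massZ_eq ?gt_eqF// gtr0_norm// mulrCA mulVf.
Qed.

End BoundedForms.

(** * Difference quotients of almost additive paths *)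

(** [F] stands for t |-> (p + t v; a) - (p; a), whose failure of additivity is a second
    difference.  Its difference quotient [g] is shown to be Cauchy at 0. *)

Section AlmostAdditive.
Context {R : realType} {W : completeNormedModType R} (F : R -> W) (d C L : R).
Hypothesis C0 : 0 <= C.
Hypothesis L0 : 0 <= L.
Hypothesis F_bound : forall s, `|s| < d -> `|F s| <= L * `|s|.
Hypothesis F_add : forall h s, `|h| < d -> `|s| < d -> `|h + s| < d ->
  `|F (h + s) - (F h + F s)| <= C * (`|h| * `|s|).

(** The i-th addition of [s] costs at most C i s^2, and these costs add up to at most
    C (m s)^2. *)
Let F_mul (m : nat) s : `|m%:R * s| < d ->
  `|F (m%:R * s) - m%:R *: F s| <= C * (m%:R * `|s|) ^+ 2.
Proof.
elim: m => [|m IH] ms.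
  rewrite mul0r in ms *; rewrite scale0r subr0 !mul0r expr0n/= mulr0.
  by have := F_bound ms; rewrite normr0 mulr0.
have le_ms (a : R) : 0 <= a -> a <= m.+1%:R -> `|a * s| < d.
  move=> a0 am; apply: le_lt_trans ms; rewrite !normrM ler_wpM2r//.
  by rewrite !ger0_norm.
have ms' : `|m%:R * s| < d by apply: le_ms; rewrite ?ler_nat.
have s' : `|s| < d by rewrite -[s]mul1r; apply: le_ms; rewrite ?ler1n.
have E : m.+1%:R * s = m%:R * s + s by rewrite -natr1 mulrDl mul1r.
have := F_add ms' s'; rewrite -E => /(_ ms) H.
rewrite -(subrKA (F (m%:R * s) + F s)) (le_trans (ler_normD _ _))//.
have -> : F (m%:R * s) + F s - m.+1%:R *: F s = F (m%:R * s) - m%:R *: F s.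
  by rewrite -natr1 scalerDl scale1r opprD addrACA subrr addr0.
apply: (le_trans (lerD H (IH ms'))); rewrite -mulrDr ler_wpM2l// normrM.
rewrite normr_nat -natr1 -subr_ge0.
have -> : ((m%:R + 1) * `|s|) ^+ 2 - (m%:R * `|s| * `|s| + (m%:R * `|s|) ^+ 2)
  = (m%:R + 1) * `|s| ^+ 2 by ring.
by rewrite mulr_ge0// ?sqr_ge0// addr_ge0.
Qed.

Let g t := t^-1 *: F t.

(** Divide t by s with remainder: t = m s + rho with |rho| <= |s|, so that F t is close
    to m F s, and (t / s) F s differs from m F s by a fraction of F s. *)
Let g_same_sign t s : t != 0 -> s != 0 -> 0 < t / s -> `|t| < d -> `|s| <= `|t| ->
  `|g t - g s| <= 2 * C * `|t| + 2 * L * `|s| / `|t|.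
Proof.
move=> t0 s0 ts_gt0 td st.
have t0' : 0 < `|t| by rewrite normr_gt0.
have s0' : 0 < `|s| by rewrite normr_gt0.
have sd : `|s| < d by exact: le_lt_trans td.
pose m := Num.truncn (t / s).
have /andP[m1 m2] := truncn_itv (ltW ts_gt0).
pose rho := t - m%:R * s.
have rhos : rho = (t / s - m%:R) * s by rewrite mulrBl divfK.
have rho_s : `|rho| <= `|s|.
  rewrite rhos normrM ler_piMl// ger0_norm ?subr_ge0//.
  by rewrite lerBlDr addrC natr1 ltW.
have mst : m%:R * `|s| <= `|t|.
  rewrite -[t in leRHS](divfK s0) normrM ler_wpM2r//.
  by rewrite ger0_norm ?(ltW ts_gt0).
have msd : `|m%:R * s| < d by rewrite normrM normr_nat (le_lt_trans mst).
have rhod : `|rho| < d by exact: le_lt_trans sd.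
have tE : t = m%:R * s + rho by rewrite /rho addrC subrK.
have H1 := F_add msd rhod; rewrite -tE in H1; have {}H1 := H1 td.
have H2 := F_mul msd.
have H3 := F_bound rhod.
have H4 := F_bound sd.
have H : `|F t - (t / s) *: F s| <= 2 * C * `|t| ^+ 2 + 2 * L * `|s|.
  have -> : F t - (t / s) *: F s = (F t - (F (m%:R * s) + F rho)) +
     (F (m%:R * s) - m%:R *: F s) + F rho - (t / s - m%:R) *: F s.
    rewrite scalerBl.
    by rewrite [X in X - (_ - _)]addrAC opprD opprB !addrA !subrK.
  have H5 : `|(t / s - m%:R) *: F s| <= L * `|s|.
    rewrite normrZ; apply: le_trans H4; rewrite ler_piMl//.
    rewrite ger0_norm ?subr_ge0//.
    by rewrite lerBlDr addrC natr1 ltW.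
  have H6 : C * (`|m%:R * s| * `|rho|) <= C * `|t| ^+ 2.
    rewrite ler_wpM2l// expr2 ler_pM//; last exact: le_trans st.
    by rewrite normrM normr_nat.
  have H7 : C * (m%:R * `|s|) ^+ 2 <= C * `|t| ^+ 2.
    by rewrite ler_wpM2l// lerXn2r// nnegrE mulr_ge0.
  have H8 : L * `|rho| <= L * `|s| by rewrite ler_wpM2l.
  rewrite (le_trans (ler_normB _ _))// (le_trans (lerD (ler_normD _ _) (lexx _)))//.
  rewrite (le_trans (lerD (lerD (ler_normD _ _) (lexx _)) (lexx _)))//.
  lra.
have -> : g t - g s = t^-1 *: (F t - (t / s) *: F s).
  by rewrite scalerBr scalerA mulrA mulVf// mul1r.
rewrite normrZ normfV ler_pdivrMl//; apply: (le_trans H).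
by rewrite le_eqVlt; apply/orP; left; apply/eqP; field; rewrite (lt0r_neq0 t0').
Qed.

(** For t < 0 compare first with - u: additivity of F at u and - u shows that g u and
    g (- u) are within C u of each other. *)
Let g_near t u : `|t| < d -> 0 < u -> u <= `|t| ->
  `|g t - g u| <= 3 * C * `|t| + 2 * L * u / `|t|.
Proof.
move=> td u0 ut.
have t0' : 0 < `|t| by exact: lt_le_trans ut.
have t0 : t != 0 by rewrite -normr_gt0.
have Ct : 0 <= C * `|t| by rewrite mulr_ge0.
have [tge0|tlt0] := ltP 0 t.
  have := @g_same_sign t u t0 (lt0r_neq0 u0) (divr_gt0 tge0 u0) td.
  rewrite (gtr0_norm u0) => /(_ ut).
  lra.
have tneg : t < 0 by rewrite lt_neqAle t0.
have Nu0 : - u < 0 by rewrite oppr_lt0.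
have tu : 0 < t / - u by rewrite -mulrNN -invrN opprK divr_gt0// oppr_gt0.
have := @g_same_sign t (- u) t0 _ tu td; rewrite normrN (gtr0_norm u0) => H.
have {}H := H (ltr0_neq0 Nu0) ut.
have ud : `|u| < d by rewrite gtr0_norm// (le_lt_trans ut).
have F0 : F 0 = 0.
  have := @F_bound 0; rewrite normr0 mulr0 (le_lt_trans _ td)// => /(_ isT).
  by rewrite normr_le0 => /eqP.
have Hu : `|g (- u) - g u| <= C * `|t|.
  have := @F_add u (- u) ud; rewrite normrN => /(_ ud).
  rewrite subrr normr0 F0 sub0r normrN => /(_ (le_lt_trans (normr_ge0 _) td)).
  rewrite /g invrN scaleNr -opprD normrN -scalerDr normrZ normfV (gtr0_norm u0).
  rewrite addrC => Hu; rewrite ler_pdivrMl//; apply: (le_trans Hu).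
  by rewrite mulrCA ler_wpM2l// ?(ltW u0)// ler_wpM2l.
rewrite -(subrKA (g (- u))) (le_trans (ler_normD _ _))//; lra.
Qed.

(** The error 2 L u / |t| in [g_near] vanishes as u tends to 0, which leaves a bound of
    |g t - g t'| by 3 C (|t| + |t'|). *)
Lemma almost_additive_cvg : 0 < d -> cvg (t^-1 *: F t @[t --> 0^']).
Proof.
move=> d0.
have gC t t' : t != 0 -> t' != 0 -> `|t| < d -> `|t'| < d ->
    `|g t - g t'| <= 3 * C * (`|t| + `|t'|).
  move=> t0 t'0 td t'd; apply/ler_addgt0Pr => e e0.
  have tp : 0 < `|t| by rewrite normr_gt0.
  have t'p : 0 < `|t'| by rewrite normr_gt0.
  pose K := (2 * L) / `|t| + (2 * L) / `|t'| + 1.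
  have K0 : 0 < K by rewrite ltr_wpDl// addr_ge0// divr_ge0// mulr_ge0.
  pose u := Num.min (Num.min `|t| `|t'|) (e / K).
  have u0 : 0 < u by rewrite !lt_min tp t'p divr_gt0.
  have ut : u <= `|t| by rewrite !ge_min lexx.
  have ut' : u <= `|t'| by rewrite !ge_min lexx orbT.
  have uK : u * K <= e by rewrite -ler_pdivlMr// !ge_min lexx orbT.
  have H := g_near td u0 ut; have H' := g_near t'd u0 ut'.
  rewrite -(subrKA (g u)) (le_trans (ler_normD _ _))// (distrC (g u)).
  have : u * K = 2 * L * u / `|t| + 2 * L * u / `|t'| + u by rewrite /K; ring.
  lra.
apply: cauchy_cvg; apply/cauchy_ballP => e e0; rewrite near_map2.
(* With |t| and |t'| below eta the bound is less than 6 C eta + eta <= e. *)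
pose eta := Num.min d (e / (6 * C + 1)).
have C1 : 0 < 6 * C + 1 by rewrite ltr_wpDl// mulr_ge0.
have eta0 : 0 < eta by rewrite lt_min d0 divr_gt0.
have etad : eta <= d by rewrite ge_min lexx.
have etae : eta * (6 * C + 1) <= e by rewrite -ler_pdivlMr// ge_min lexx orbT.
near=> t t'.
have t0 : t != 0 by near: t; exact: nbhs_dnbhs_neq.
have t'0 : t' != 0 by near: t'; exact: nbhs_dnbhs_neq.
have te : `|t| < eta by near: t; exact: dnbhs0_lt.
have t'e : `|t'| < eta by near: t'; exact: dnbhs0_lt.
rewrite -ball_normE/=; apply: (le_lt_trans (gC _ _ t0 t'0 _ _)).
- exact: lt_le_trans etad.
- exact: lt_le_trans etad.
apply: lt_le_trans etae.
have H : C * (`|t| + `|t'|) <= C * (eta + eta) by rewrite ler_wpM2l// lerD// ltW.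
lra.
Unshelve. all: by end_near. Qed.

End AlmostAdditive.

(** * Convex hulls of finite sets in an open set *)

Section ConvexSets.
Context {R : realType} {V : normedModType R}.
Implicit Types (A K : set V).

Lemma convex_setE A : @convex_set R V A <->
  (forall x y (l : R), 0 <= l -> l <= 1 -> A x -> A y -> A (l *: x + (1 - l) *: y)).
Proof.
split=> [cA x y l l0 l1 xA yA|cA x y l].
  by have := cA x y (Itv01 l0 l1); rewrite !inE; apply.
by rewrite !inE => xA yA; apply: cA.
Qed.

Definition cone (x : V) K : set V :=
  [set l *: x + (1 - l) *: y | l in `[0, 1] & y in K].

Lemma sub_cone x K : K `<=` cone x K.
Proof.
move=> y Ky; exists 0; first by rewrite /= in_itv/= lexx ler01.
by exists y => //; rewrite scale0r add0r subr0 scale1r.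
Qed.

Lemma cone_apex x K y : K y -> cone x K x.
Proof.
move=> Ky; exists 1; first by rewrite /= in_itv/= lexx ler01.
by exists y => //; rewrite scale1r subrr scale0r addr0.
Qed.

Lemma cone_min x K C : @convex_set R V C -> C x -> K `<=` C -> cone x K `<=` C.
Proof.
move=> /convex_setE cC Cx KC _ [l l01 [y /KC Cy <-]].
move: l01; rewrite /= in_itv/= => /andP[l0 l1].
exact: cC.
Qed.

(** Collect the weights a and b of the two points of [K]; when a + b > 0 these points are
    replaced by their barycentre, and otherwise only the apex remains. *)
Lemma convex_cone x K : @convex_set R V K -> @convex_set R V (cone x K).
Proof.
move=> /convex_setE cK; apply/convex_setE => p q c c0 c1.
move=> [l l01 [y Ky <-]] [m m01 [z Kz <-]]; move: l01 m01; rewrite /= !in_itv/=.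
move=> /andP[l0 l1] /andP[m0 m1].
pose a := c * (1 - l); pose b := (1 - c) * (1 - m).
have a0 : 0 <= a by rewrite mulr_ge0 ?subr_ge0.
have b0 : 0 <= b by rewrite mulr_ge0 ?subr_ge0.
have lm : c * l + (1 - c) * m = 1 - (a + b) by rewrite /a /b; ring.
have lm0 : 0 <= 1 - (a + b) by rewrite -lm addr_ge0// mulr_ge0// subr_ge0.
have -> : c *: (l *: x + (1 - l) *: y) + (1 - c) *: (m *: x + (1 - m) *: z) =
    (1 - (a + b)) *: x + (a *: y + b *: z).
  by rewrite -lm !scalerDr !scalerA addrACA -scalerDl.
have ab1 : 1 - (a + b) <= 1 by rewrite gerBl addr_ge0.
have xin : 1 - (a + b) \in `[0, 1] by rewrite in_itv/= lm0.
have [ab|ab] := eqVneq (a + b) 0.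
  have /eqP := ab; rewrite paddr_eq0// => /andP[/eqP -> /eqP ->].
  rewrite !scale0r !addr0 subr0 scale1r; exact: cone_apex Ky.
exists (1 - (a + b)) => //.
have ab0 : 0 < a + b by rewrite lt_neqAle eq_sym ab addr_ge0.
exists ((a / (a + b)) *: y + (1 - a / (a + b)) *: z).
  by apply: cK => //; [rewrite divr_ge0// ltW|rewrite ler_pdivrMr// mul1r lerDl].
congr (_ + _); rewrite subKr scalerDr !scalerA.
by congr (_ *: _ + _ *: _); field.
Qed.

Lemma compact_cone x K : compact K -> compact (cone x K).
Proof.
move=> cK; pose f (t : R^o * V) := t.1 *: x + (1 - t.1) *: t.2.
have -> : cone x K = f @` ((`[0, 1] : set R) `*` K).
  apply/seteqP; split=> [_ [l l01 [y Ky <-]]|_ [[l y]/= [l01 Ky] <-]].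
    by exists (l, y).
  by exists l => //; exists y.
apply: continuous_compact; last by apply: compact_setX => //; exact: segment_compact.
apply: continuous_subspaceT => t.
apply: cvgD.
  by apply: cvgZr_tmp; exact: cvg_fst.
apply: cvgZ; last exact: cvg_snd.
by apply: cvgB; [exact: cvg_cst|exact: cvg_fst].
Qed.

Definition thickening (d : R) K : set V := [set z | exists2 y, K y & `|z - y| < d].

Lemma convex_thickening d K : @convex_set R V K -> @convex_set R V (thickening d K).
Proof.
move=> /convex_setE cK; apply/convex_setE => z z' l l0 l1 [y Ky zy] [y' Ky' zy'].
exists (l *: y + (1 - l) *: y'); first exact: cK.
rewrite opprD addrACA -!scalerBr (le_lt_trans (ler_normD _ _))// !normrZ.
rewrite (ger0_norm l0) ger0_norm ?subr_ge0//.
have -> : d = l * d + (1 - l) * d by ring.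
have [->|lneq0] := eqVneq l 0.
  by rewrite !mul0r !add0r subr0 !mul1r.
apply: ltr_leD; first by rewrite ltr_pM2l// lt_neqAle eq_sym lneq0.
by rewrite ler_wpM2l ?subr_ge0// ltW.
Qed.

(** Near each point of [K] the same radius, half of one that fits in [U], works for all
    points of a neighbourhood; compactness gives a uniform radius. *)
Lemma compact_thickening K (U : set V) : compact K -> open U -> K `<=` U ->
  exists2 d, 0 < d & thickening d K `<=` U.
Proof.
move=> /compact_near_coveringP cK oU KU.
have H : \forall d \near (0 : R)^'+, K `<=` (fun y => ball y d `<=` U).
  apply: (cK R (0 : R)^'+ (fun d y => ball y d `<=` U)) => x /KU Ux.
  have /nbhs_ballP[d /= d0 dU] : nbhs x U by exact: open_nbhs_nbhs.
  have d20 : 0 < d / 2 by rewrite divr_gt0.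
  exists (ball x (d / 2), [set h | h < d / 2]) => /=.
    by split; [exact: nbhsx_ballx|exact: nbhs_right_lt].
  move=> [y h]/= [xy hd] z yz; apply: dU; rewrite [d]splitr.
  by apply: ball_triangle xy _; apply: le_ball yz; exact: ltW.
have [d [d0 dK]] := filter_ex (filterI (nbhs_right_gt 0) H).
exists d => // z [y Ky zy]; apply: (dK y Ky); rewrite -ball_normE/= distrC.
exact: zy.
Qed.

End ConvexSets.

Section Inside.
Context {R : realType} {n : nat}.
Implicit Types (U S K : set 'rV[R]_n) (k : nat) (u v p : 'rV[R]_n).

Lemma convex_hull_min S K :
  @convex_set R 'rV[R]_n K -> S `<=` K -> convex_hull S `<=` K.
Proof. by move=> cK SK p; apply; split. Qed.

(** Adding a vertex replaces a polytope by the cone over it, which is a continuous image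
    of [0, 1] x K. *)
Lemma compact_hull_finite S : finite_set S -> exists K,
  [/\ compact K, @convex_set R 'rV[R]_n K, S `<=` K & K `<=` convex_hull S].
Proof.
move=> /finite_seqP[s ->]; elim: s => [|x s [K [cK vK sK Ks]]].
  by exists set0; split=> //; first exact: compact0.
have sub_hull : convex_hull [set` s] `<=` convex_hull [set` x :: s].
  move=> p ps C [cC sC]; apply: ps; split=> // q qs; apply: sC.
  by rewrite /= inE qs orbT.
case: s sK Ks sub_hull => [_ _ _|y s sK Ks sub_hull].
  exists [set x]; split.
  - exact: compact_set1.
  - apply/(@convex_setE R 'rV[R]_n) => a b l l0 l1 -> ->.
    by rewrite -scalerDl addrC subrK scale1r.
  - by move=> q /=; rewrite inE => /eqP.
  - by move=> q -> ; apply: sub_convex_hull; rewrite /= inE.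
exists (cone x K); split.
- exact: compact_cone.
- exact: convex_cone.
- move=> q /=; rewrite inE => /orP[/eqP ->|qs].
    by apply: (@cone_apex _ _ _ _ y); apply: sK; rewrite /= inE eqxx.
  exact/sub_cone/sK.
- move=> q qK C [cC sC]; apply: (cone_min cC _ _ qK).
    by apply: sC; rewrite /= inE eqxx.
  by move=> z /Ks /sub_hull; apply; split.
Qed.

Lemma inside_ball U p (d : R) k (A : 'rV[R]_n -> ext R n k) :
  ball p d `<=` U -> supp A `<=` ball p d -> inside U A.
Proof.
move=> dU Ad q qA; apply: dU.
have cp : @convex_set R 'rV[R]_n [set p].
  apply/(@convex_setE R 'rV[R]_n) => a b l _ _ -> ->.
  by rewrite -scalerDl addrC subrK scale1r.
have := @convex_hull_min (supp A) _ (convex_thickening (d := d) cp).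
move=> /(_ _ q qA)[|_ ->].
  by move=> z /Ad; rewrite -ball_normE/= distrC => zp; exists p.
by rewrite -ball_normE/= distrC.
Qed.

(** The support moves by at most |t| |v| away from a compact convex set in [U], hence
    stays in a convex neighbourhood of this set contained in [U]. *)
Lemma inside_delta_near U k (A : 'rV[R]_n -> ext R n k) v : open U ->
  finite_set (supp A) -> inside U A ->
  \forall t \near (0 : R), inside U (delta (t *: v) A).
Proof.
move=> oU fA AU; have [K [cK vK AK KA]] := compact_hull_finite fA.
have [d d0 dU] := compact_thickening cK oU (subset_trans KA AU).
have v1 : 0 < `|v| + 1 by rewrite ltr_wpDl.
near=> t; apply: subset_trans dU; apply: convex_hull_min.
  exact: convex_thickening.
move=> q /supp_delta[/AK Kq|[p /AK Kp <-]].
  by exists q; rewrite ?subrr ?normr0.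
exists p => //; rewrite addrC addKr normrZ.
have t1 : `|t| < d / (`|v| + 1).
  near: t; exists (d / (`|v| + 1)); first by rewrite /= divr_gt0.
  by move=> t; rewrite /= sub0r normrN.
rewrite (@le_lt_trans _ _ (`|t| * (`|v| + 1)))// -?ltr_pdivlMr//.
by rewrite ler_wpM2l// lerDl.
Unshelve. all: by end_near. Qed.

(** A Dirac chain in [U] need not be inside [U], but finitely many points of [U] stay in
    [U] under a small translation. *)
Lemma delta_dirac_pred_near U k (A : dirac_chain U k) v : open U ->
  \forall t \near (0 : R), delta (t *: v) A \in dirac_pred U (k := k).
Proof.
move=> oU; case: A => A /= /asboolP[fA AU].
have H : \forall t \near (0 : R), supp A `<=` (fun p => U (p + t *: v)).
  move/finite_compact : (fA) => /compact_near_coveringP cA.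
  apply: (cA R (nbhs (0 : R)) (fun t p => U (p + t *: v))) => p /AU Up.
  have c : (fun z : 'rV[R]_n * R^o => z.1 + z.2 *: v) @ (nbhs p, nbhs (0 : R)) --> p.
    rewrite -[X in _ --> X]addr0 -[X in _ + X](scale0r v).
    by apply: cvgD; [exact: cvg_fst|apply: cvgZr_tmp; exact: cvg_snd].
  by apply: c; exact: open_nbhs_nbhs.
near=> t; apply/asboolP; split; first exact: finite_supp_delta.
move=> q /supp_delta[/AU//|[p Ap <-]].
by move: p Ap; near: t.
Unshelve. all: by end_near. Qed.

End Inside.

(** * The prederivative *)

Section DiracOf.
Context {R : realType} {n : nat}.
Implicit Types (U : set 'rV[R]_n) (k : nat) (u v p : 'rV[R]_n).

(** The second difference is what keeps u |-> Delta_u from being additive. *)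
Lemma delta_add k u v (A : 'rV[R]_n -> ext R n k) :
  delta (u + v) A = delta v (delta u A) + (delta u A + delta v A).
Proof.
apply/funext => q; rewrite -[LHS]/(A (q - (u + v)) - A q).
rewrite -[RHS]/((A (q - v - u) - A (q - v)) - (A (q - u) - A q) +
  ((A (q - u) - A q) + (A (q - v) - A q))).
by rewrite addrA subrK addrA subrK (addrC u) opprD addrA.
Qed.

Lemma dirac_of_linear U k c (A B : 'rV[R]_n -> ext R n k) :
  A \in dirac_pred U (k := k) -> B \in dirac_pred U (k := k) ->
  dirac_of U (c *: A + B) = c *: dirac_of U A + dirac_of U B.
Proof.
move=> AU BU; apply: val_inj; rewrite /= !dirac_ofK//.
by apply: (dirac_pred_submod U k).2.
Qed.

Lemma dirac_predD U k (A B : 'rV[R]_n -> ext R n k) :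
  A \in dirac_pred U (k := k) -> B \in dirac_pred U (k := k) ->
  A + B \in dirac_pred U (k := k).
Proof.
by move=> AU BU; rewrite -[A]scale1r; exact: (dirac_pred_submod U k).2.
Qed.

Lemma dirac_ofD U k (A B : 'rV[R]_n -> ext R n k) :
  A \in dirac_pred U (k := k) -> B \in dirac_pred U (k := k) ->
  dirac_of U (A + B) = dirac_of U A + dirac_of U B.
Proof.
by move=> AU BU; have := dirac_of_linear 1 AU BU; rewrite !scale1r.
Qed.

Lemma dirac_of_notin U k (A : 'rV[R]_n -> ext R n k) :
  A \notin dirac_pred U (k := k) -> dirac_of U A = 0.
Proof. by move=> AU; apply: val_inj; rewrite val_insubd (negbTE AU). Qed.

Lemma dirac_ofZ U k c (A : 'rV[R]_n -> ext R n k) :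
  dirac_of U (c *: A) = c *: dirac_of U A.
Proof.
have [->|c0] := eqVneq c 0; first by rewrite !scale0r (dirac_of_fun 0).
have predZ d (B : 'rV[R]_n -> ext R n k) :
    B \in dirac_pred U (k := k) -> d *: B \in dirac_pred U (k := k).
  by move=> BU; have := (dirac_pred_submod U k).2 d _ _ BU (dirac_pred_submod U k).1;
    rewrite addr0.
have [AU|AU] := boolP (A \in dirac_pred U (k := k)).
  by apply: val_inj; rewrite /= !dirac_ofK// predZ.
rewrite !dirac_of_notin ?scaler0//; apply: contra AU => /(predZ c^-1).
by rewrite scalerA mulVf// scale1r.
Qed.

Lemma dirac_in_pred U k p (a : ext R n k) : U p ->
  dirac p a \in dirac_pred U (k := k).
Proof.
move=> Up; apply: inside_dirac_pred; first exact: finite_supp_dirac.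
exact: inside_dirac.
Qed.

Lemma dirac_decomposition U k (A : dirac_chain U k) :
  exists s : seq 'rV[R]_n, [/\ uniq s, supp A = [set` s],
    {in s, forall p, U p} & A = \sum_(p <- s) dirac_of U (dirac p (A p))].
Proof.
have [/finite_seqP[s0 sA] AU] : finite_set (supp A) /\ supp A `<=` U.
  by case: A => A /= /asboolP.
pose s := undup s0.
have {}sA : supp A = [set` s].
  by rewrite sA; apply/seteqP; split=> p /=; rewrite mem_undup.
have sU : {in s, forall p, U p} by move=> p ps; apply: AU; rewrite sA.
exists s; split=> //; first exact: undup_uniq.
apply: val_inj; rewrite /= dirac_fun_sum; apply/funext => q.
rewrite fct_sumE big_seq (eq_bigr (fun p => dirac p (A p) q)) => [|p /sU Up].
  rewrite -big_seq; have [qs|qs] := boolP (q \in s).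
    rewrite (bigD1_seq q) ?undup_uniq//= /dirac eqxx big1 ?addr0// => p.
    by rewrite eq_sym => /negbTE ->.
  rewrite big_seq big1 => [|p ps].
    apply/eqP; apply: contraNT qs => qA.
    by have : supp A q by []; rewrite sA.
  by rewrite /dirac; case: eqP => // qp; rewrite qp ps in qs.
by rewrite dirac_ofK// dirac_in_pred.
Qed.

End DiracOf.

Section Prederivative.
Context {R : realType} {n : nat} (ip : {dot 'rV[R]_n for idfun}).
Context (U : set 'rV[R]_n).
Hypothesis U_open : open U.
Implicit Types (r s k : nat) (u v p : 'rV[R]_n).

Lemma link_extension r s k : (r <= s)%N ->
  linear (@link R n ip U r s k) /\ continuous (@link R n ip U r s k).
Proof.
move=> rs.
have [||lL cL _] := @extend_bounded R _ (Bseminorm ip U r k) (Bhat ip U s k)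
  (@Bembed R n ip U s k) 1; last by split.
- exact: Bembed_linear.
- by move=> A; rewrite mul1r Bembed_norm; exact: Bnorm_le.
Qed.

Lemma inside_delta_ball p d u k (a : ext R n k) : ball p d `<=` U ->
  `|u| < d -> inside U (delta u (dirac p a)).
Proof.
move=> dU ud; apply: inside_ball dU _ => q /supp_delta[/supp_dirac ->|].
  by rewrite -ball_normE/= subrr normr0 (le_lt_trans _ ud).
move=> [_ /supp_dirac -> <-]; rewrite -ball_normE/= opprD addrA subrr add0r.
by rewrite normrN.
Qed.

Lemma inside_delta2_ball p d u v k (a : ext R n k) : ball p d `<=` U ->
  `|u| < d -> `|v| < d -> `|u + v| < d ->
  inside U (delta v (delta u (dirac p a))).
Proof.
move=> dU ud vd uvd; apply: inside_ball dU _.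
have H q : supp (delta u (dirac p a)) q -> q = p \/ q = p + u.
  by move=> /supp_delta[/supp_dirac ->|[_ /supp_dirac -> <-]]; [left|right].
have pw w : `|w| < d -> ball p d (p + w).
  by move=> wd; rewrite -ball_normE/= opprD addrA subrr add0r normrN.
have p0 : ball p d p by apply: ballxx; exact: le_lt_trans ud.
move=> q /supp_delta[/H[->|->]//|]; first exact: pw.
move=> [q' /H[->|->] <-]; first exact: pw.
by rewrite -addrA; exact: pw.
Qed.

Lemma vnorm_ge0 v : 0 <= vnorm ip v. Proof. exact: sqrtr_ge0. Qed.

(** As long as the points p, p + h v, p + s v and p + (h + s) v lie in a ball contained in
    [U], the second difference is a single term with two difference vectors, of
    mass |h| |s| |v|^2 |a|. *)
Lemma dirac_P_cvg v k p (a : ext R n k) : U p ->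
  t^-1 *: Bembed ip 2 (dirac_of U (delta (t *: v) (dirac p a))) @[t --> 0^']
    --> dirac_P ip U v p a.
Proof.
move=> Up.
have /nbhs_ballP[d /= d0 dU] : nbhs p U by exact: open_nbhs_nbhs.
pose F t := Bembed ip 2 (dirac_of U (delta (t *: v) (dirac p a))).
(* The increment 1 avoids a division by zero when v = 0. *)
have v1 : 0 < `|v| + 1 by rewrite ltr_wpDl.
have v1d h : `|h| < d / (`|v| + 1) -> `|h *: v| < d.
  rewrite ltr_pdivlMr// => hd; rewrite normrZ; apply: le_lt_trans hd.
  by rewrite ler_wpM2l// lerDl.
have iF h : `|h| < d / (`|v| + 1) -> inside U (delta (h *: v) (dirac p a)).
  by move=> /v1d; exact: inside_delta_ball.
have H : cvg (t^-1 *: F t @[t --> 0^']).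
  apply: (@almost_additive_cvg _ _ F (d / (`|v| + 1))
    (vnorm ip v * vnorm ip v * mass ip a) (vnorm ip v * mass ip a)).
  - by rewrite !mulr_ge0 ?vnorm_ge0 ?mass_ge0.
  - by rewrite mulr_ge0 ?vnorm_ge0 ?mass_ge0.
  - move=> h hd; rewrite Bembed_norm.
    apply: (le_trans (@Bnorm_dterm _ _ ip U 2 k ([:: h *: v], p, a) _ _)) => //.
      exact: iF.
    by rewrite /dterm_mass/= big_seq1 vnormZ -[leLHS]mulrA [leLHS]mulrC.
  - move=> h s hd sd hsd.
    pose t : @dterm R n k := ([:: h *: v; s *: v], p, a).
    have tU : inside U (dterm_chain t).
      apply: (@inside_delta2_ball p d _ _ _ _ dU); [exact: v1d|exact: v1d|].
      by rewrite -scalerDl; exact: v1d.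
    have -> : F (h + s) - (F h + F s) = Bembed ip 2 (dirac_of U (dterm_chain t)).
      rewrite -[RHS](addrK (F h + F s)); congr (_ - _).
      rewrite /F scalerDl delta_add -/(dterm_chain t).
      have Hh := inside_dirac_pred (finite_supp_dterm ([:: h *: v], p, a)) (iF _ hd).
      have Hs := inside_dirac_pred (finite_supp_dterm ([:: s *: v], p, a)) (iF _ sd).
      rewrite (dirac_ofD (dterm_dirac_pred tU) (dirac_predD Hh Hs)) (dirac_ofD Hh Hs).
      by rewrite !BembedD.
    rewrite Bembed_norm (le_trans (Bnorm_dterm _ _ _))//.
    rewrite /dterm_mass/= big_cons big_seq1 !vnormZ.
    by rewrite le_eqVlt; apply/orP; left; apply/eqP; ring.
  by rewrite divr_gt0.
rewrite /dirac_P; set G := (fun t : R => Bembed ip 2 _).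
suff -> : G = (fun t => t^-1 *: F t) by exact: H.
apply/funext => t; rewrite /G /F diracZ -[delta _ _]/(deltas [:: t *: v] _).
by rewrite deltasZ dirac_ofZ BembedZ.
Qed.

Lemma link_dirac_P_cvg s v k p (a : ext R n k) : (2 <= s)%N -> U p ->
  t^-1 *: Bembed ip s (dirac_of U (delta (t *: v) (dirac p a))) @[t --> 0^']
    --> link s (dirac_P ip U v p a).
Proof.
move=> s2 Up; have [lL cL] := @link_extension 2 s k s2.
have H := continuous_cvg_comp cL (@dirac_P_cvg v k p a Up).
apply: (near_cvg_eq H); apply: nearW => t /=.
pose L : {linear Bhat ip U 2 k -> Bhat ip U s k} :=
  HB.pack (@link R n ip U 2 s k) (GRing.isLinear.Build R _ _ _ _ lL).
by rewrite -[LHS]/(L (t^-1 *: _)) linearZ/= link_embed.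
Qed.

Definition difference_quotient s v k (A : dirac_chain U k) (t : R) : Bhat ip U s k :=
  t^-1 *: Bembed ip s (dirac_of U (delta (t *: v) A)).

Lemma difference_quotient_cvg_linear s v k c (A B : dirac_chain U k)
    (lA lB : Bhat ip U s k) :
  difference_quotient s v A @ 0^' --> lA ->
  difference_quotient s v B @ 0^' --> lB ->
  difference_quotient s v (c *: A + B) @ 0^' --> c *: lA + lB.
Proof.
move=> HA HB; apply: (near_cvg_eq (cvg_scaleD (c := c) HA HB)).
have PA := @delta_dirac_pred_near R n U k A v U_open.
have PB := @delta_dirac_pred_near R n U k B v U_open.
near=> t; rewrite /difference_quotient/=.
have -> : delta (t *: v) (c *: A + B : dirac_chain U k) =
    c *: delta (t *: v) A + delta (t *: v) B.
  exact: delta_linear.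
rewrite dirac_of_linear; first last.
- by near: t; apply: cvg_within; exact: PB.
- by near: t; apply: cvg_within; exact: PA.
rewrite BembedD BembedZ scalerDr !scalerA mulrC.
by rewrite -scalerA.
Unshelve. all: by end_near. Qed.

Lemma difference_quotient_cvg_add s v k (A B : dirac_chain U k)
    (lA lB : Bhat ip U s k) :
  difference_quotient s v A @ 0^' --> lA ->
  difference_quotient s v B @ 0^' --> lB ->
  difference_quotient s v (A + B) @ 0^' --> lA + lB.
Proof.
move=> HA HB; rewrite -(scale1r A) -(scale1r lA).
exact: difference_quotient_cvg_linear.
Qed.

Lemma difference_quotient_dirac s v k p (a : ext R n k) : (2 <= s)%N -> U p ->
  difference_quotient s v (dirac_of U (dirac p a)) @ 0^' -->
    link s (dirac_P ip U v p a).
Proof.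
move=> s2 Up; apply: (near_cvg_eq (@link_dirac_P_cvg s v k p a s2 Up)).
apply: nearW => t; rewrite /difference_quotient.
by rewrite dirac_ofK// dirac_in_pred.
Qed.

(** The map of which [chain_P] is the continuous extension when s = max (r + 1) 2. *)
Definition dirac_chain_P s v k (A : dirac_chain U k) : Bhat ip U s k :=
  \sum_(p \in supp A) link s (dirac_P ip U v p (A p)).

Lemma dirac_chain_P_cvg s v k (A : dirac_chain U k) : (2 <= s)%N ->
  difference_quotient s v A @ 0^' --> dirac_chain_P s v A.
Proof.
move=> s2; rewrite /dirac_chain_P.
have [l [ul -> lU AE]] := dirac_decomposition A; rewrite -fsbig_seq//.
rewrite {1}AE; elim: l lU {ul AE} => [_|p l IH lU].
  rewrite !big_nil; apply: (near_cvg_eq (cvg_cst 0)).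
  apply: nearW => t; rewrite /difference_quotient.
  rewrite (_ : delta _ _ = 0); last exact: delta0.
  by rewrite (dirac_of_fun 0) Bembed0 scaler0.
rewrite !big_cons; apply: difference_quotient_cvg_add; last first.
  by apply: IH => q ql; apply: lU; rewrite inE ql orbT.
by apply: difference_quotient_dirac => //; apply: lU; rewrite inE eqxx.
Qed.

Lemma dirac_chain_P_linear s v k : (2 <= s)%N -> linear (@dirac_chain_P s v k).
Proof.
move=> s2 c A B.
have H D := @dirac_chain_P_cvg s v k D s2.
exact: norm_cvg_unique (H _) (difference_quotient_cvg_linear (H A) (H B)).
Qed.

(** Applying Delta_(tv) / t to a term appends the vector t v to its differences and
    multiplies its mass by |v|; for small t the result is inside [U]. *)
Lemma dirac_chain_P_bounded r s v k : (2 <= s)%N -> (r < s)%N ->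
  forall A : dirac_chain U k, `|dirac_chain_P s v A| <= vnorm ip v * Bnorm ip r A.
Proof.
move=> s2 rs; apply: bounded_on_dterms; first exact: vnorm_ge0.
  exact: dirac_chain_P_linear.
move=> t tr tU; set A := dirac_of U _.
apply: (norm_cvg_le (@dirac_chain_P_cvg s v k A s2)); near=> h.
have AE : A = dterm_chain t :> (_ -> _) by rewrite /A dirac_ofK ?dterm_dirac_pred.
have h0 : h != 0 by near: h; exact: nbhs_dnbhs_neq.
rewrite normrZ normfV ler_pdivrMl ?normr_gt0// Bembed_norm AE.
pose t' : @dterm R n k := (rcons t.1.1 (h *: v), t.1.2, t.2).
have t'E : dterm_chain t' = delta (h *: v) (dterm_chain t).
  by rewrite /dterm_chain/= deltas_rcons.
rewrite -t'E (le_trans (Bnorm_dterm _ _ _))//.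
- by rewrite size_rcons (leq_ltn_trans tr).
- rewrite t'E; near: h; apply: cvg_within.
  by apply: inside_delta_near => //; exact: finite_supp_dterm.
- rewrite /dterm_mass/= -cats1 big_cat/= big_seq1 vnormZ.
  by rewrite le_eqVlt; apply/orP; left; apply/eqP; ring.
Unshelve. all: by end_near. Qed.

Lemma chain_P_extension r v k :
  [/\ linear (@chain_P R n ip U r v k), continuous (@chain_P R n ip U r v k) &
      forall A : dirac_chain U k,
        chain_P v (Bembed ip r A) = dirac_chain_P (maxn r.+1 2) v A].
Proof.
apply: (@extend_bounded R _ (Bseminorm ip U r k) (Bhat ip U (maxn r.+1 2) k)
  (dirac_chain_P (maxn r.+1 2) v (k := k)) (vnorm ip v)).
  by apply: dirac_chain_P_linear; exact: leq_maxr.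
by apply: dirac_chain_P_bounded; [exact: leq_maxr|exact: leq_maxl].
Qed.

End Prederivative.

Section PrederivativeBilinear.
Context {R : realType} {n : nat} (ip : {dot 'rV[R]_n for idfun}).
Context (U : set 'rV[R]_n).
Hypothesis U_open : open U.
Context (s k : nat).
Hypothesis s_ge2 : (2 <= s)%N.
Implicit Types (u v p : 'rV[R]_n) (a b : ext R n k).

Lemma dirac_chain_P_dirac v p a : U p ->
  dirac_chain_P ip s v (dirac_of U (dirac p a)) = link s (dirac_P ip U v p a).
Proof.
move=> Up.
have H := @dirac_chain_P_cvg _ _ ip U U_open s v k (dirac_of U (dirac p a)) s_ge2.
apply: (norm_cvg_unique H); exact: difference_quotient_dirac.
Qed.

Lemma dirac_P_vector_linear v p : U p ->
  linear (fun a => link s (dirac_P ip U v p a) : Bhat ip U s k).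
Proof.
move=> Up c a b; have E x := dirac_chain_P_dirac v x Up.
have L := @dirac_chain_P_linear _ _ ip U U_open s v k s_ge2.
apply: (etrans (esym (E _))).
apply: (etrans _ (congr2 (fun x y => c *: x + y) (E a) (E b))).
apply: (etrans _ (L c _ _)); congr (dirac_chain_P ip s v _).
apply: (etrans _ (dirac_of_linear c (dirac_in_pred a Up) (dirac_in_pred b Up))).
congr dirac_of; apply/funext => q.
rewrite -[RHS]/(c *: dirac p a q + dirac p b q) /dirac.
by case: ifP => //; rewrite scaler0 addr0.
Qed.

(** For c <> 0, substitute c t for t in the limit; for c = 0 the quotients vanish. *)
Lemma dirac_P_direction_scale c v p a : U p ->
  link s (dirac_P ip U (c *: v) p a) = c *: link s (dirac_P ip U v p a).
Proof.
move=> Up; have H w := @difference_quotient_dirac _ _ ip U U_open s w k p a s_ge2 Up.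
have [->|c0] := eqVneq c 0.
  rewrite !scale0r; apply: (norm_cvg_unique (H 0)).
  apply: (near_cvg_eq (cvg_cst 0)); apply: nearW => t.
  by rewrite /difference_quotient scaler0 delta_vec0 (dirac_of_fun 0) Bembed0 scaler0.
have cc : c * t @[t --> (0:R)^'] --> (0 : R)^'.
  move=> A /nbhs_ballP[d /= d0 dA]; exists (d / `|c|).
    by rewrite /= divr_gt0// normr_gt0.
  move=> t /=; rewrite sub0r normrN => td t0; apply: dA.
    by rewrite -ball_normE/= sub0r normrN normrM mulrC -ltr_pdivlMr// normr_gt0.
  by rewrite mulf_neq0.
apply: (norm_cvg_unique (H (c *: v))).
apply: (near_cvg_eq (cvg_scale (c := c) (norm_cvg_reindex cc (H v)))); apply: nearW => t.
have vE : t *: (c *: v) = (c * t) *: v by rewrite scalerA mulrC.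
have tE : c * (c * t)^-1 = t^-1 by rewrite invfM mulrA divff// mul1r.
by rewrite /difference_quotient vE scalerA tE.
Qed.

(** By [delta_add] the quotients differ from additivity by 1 / t times a second
    difference, whose norm in order 2 is at most t^2 |u| |v| |a|. *)
Lemma dirac_P_direction_add u v p a : U p ->
  link s (dirac_P ip U (u + v) p a) =
  link s (dirac_P ip U u p a) + link s (dirac_P ip U v p a).
Proof.
move=> Up; have H w := @difference_quotient_dirac _ _ ip U U_open s w k p a s_ge2 Up.
have /nbhs_ballP[d /= d0 dU] : nbhs p U by exact: open_nbhs_nbhs.
pose t2 t : @dterm R n k := ([:: t *: u; t *: v], p, a).
pose M := vnorm ip u * (vnorm ip v * mass ip a).
have M0 : 0 <= M by rewrite !mulr_ge0 ?vnorm_ge0 ?mass_ge0.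
have small w : \forall t \near (0 : R)^', `|t *: w| < d.
  have w1 : 0 < `|w| + 1 by rewrite ltr_wpDl.
  near=> t; have t1 : `|t| < d / (`|w| + 1).
    by near: t; apply: dnbhs0_lt; rewrite divr_gt0.
  rewrite normrZ (@le_lt_trans _ _ (`|t| * (`|w| + 1)))// -?ltr_pdivlMr//.
  by rewrite ler_wpM2l// lerDl.
have t2U : \forall t \near (0 : R)^', inside U (dterm_chain (t2 t)).
  near=> t; apply: (@inside_delta2_ball _ _ _ p d _ _ _ _ dU).
  - by near: t; exact: small.
  - by near: t; exact: small.
  - by rewrite -scalerDr; near: t; exact: small.
have H0 : t^-1 *: Bembed ip s (dirac_of U (dterm_chain (t2 t))) @[t --> 0^'] --> 
    (0 : Bhat ip U s k).
  apply/cvgr0Pnorm_le => eps eps0; near=> t.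
  have t0 : t != 0 by near: t; exact: nbhs_dnbhs_neq.
  rewrite normrZ normfV ler_pdivrMl ?normr_gt0// Bembed_norm.
  apply: le_trans (_ : _ <= dterm_mass ip (t2 t)) _.
    by apply: Bnorm_dterm => //; near: t.
  rewrite /dterm_mass/= big_cons big_seq1 !vnormZ.
  have -> : `|t| * vnorm ip u * (`|t| * vnorm ip v) * mass ip a = `|t| * (`|t| * M).
    by rewrite /M; ring.
  rewrite ler_wpM2l//.
  have t1 : `|t| < eps / (M + 1).
    by near: t; apply: dnbhs0_lt; rewrite divr_gt0// ltr_wpDl.
  rewrite (@le_trans _ _ (`|t| * (M + 1)))//; first by rewrite ler_wpM2l// lerDl.
  by rewrite -ler_pdivlMr ?ltW// ltr_wpDl.
apply: (etrans _ (congr1 (fun x => x + _) (add0r _))).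
apply: (norm_cvg_unique (H (u + v))).
apply: (near_cvg_eq (norm_cvgD (norm_cvgD H0 (H u)) (H v))); near=> t.
rewrite /difference_quotient/= dirac_ofK ?dirac_in_pred// -!scalerDr; congr (_ *: _).
have -> : delta (t *: (u + v)) (dirac p a) = dterm_chain (t2 t) +
    (delta (t *: u) (dirac p a) + delta (t *: v) (dirac p a)).
  by rewrite scalerDr delta_add.
have dpred w : `|t *: w| < d ->
    delta (t *: w) (dirac p a) \in dirac_pred U (k := k).
  move=> td; apply: inside_dirac_pred.
    exact/finite_supp_delta/finite_supp_dirac.
  exact: inside_delta_ball dU td.
have pu : delta (t *: u) (dirac p a) \in dirac_pred U (k := k).
  by apply: dpred; near: t; exact: small.
have pv : delta (t *: v) (dirac p a) \in dirac_pred U (k := k).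
  by apply: dpred; near: t; exact: small.
have p2 : dterm_chain (t2 t) \in dirac_pred U (k := k).
  by apply: dterm_dirac_pred; near: t.
rewrite (dirac_ofD p2 (dirac_predD pu pv)) (dirac_ofD pu pv).
by rewrite !BembedD addrA.
Unshelve. all: by end_near. Qed.

End PrederivativeBilinear.

(** * Contraction, exterior products and perpendicular complement *)

Section Contraction.
Context {R : realType} {n : nat} (ip : {dot 'rV[R]_n for idfun}).
Context (e : 'I_n -> 'rV[R]_n).
Hypothesis e_orthonormal : forall i j : 'I_n, ip (e i) (e j) = (i == j)%:R.

(** With [Q v a] the derivative along [v] of a form evaluated on [a], the left-hand
    side is the form on the boundary of (p; a) and the right-hand side its exterior
    derivative.  On a basis k-vector the coefficients <e_i, b_j> of the contractions move into the
    first argument of [Q], where \sum_i <e_i, b_j> e_i = b_j. *)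
Lemma contraction_sum k (W : lmodType R) (Q : 'rV[R]_n -> ext R n k -> W) :
  (forall v, linear (Q v)) ->
  (forall u v a, Q (u + v) a = Q u a + Q v a) ->
  (forall c v a, Q (c *: v) a = c *: Q v a) ->
  forall a : ext R n k.+1,
  \sum_(i < n) Q (e i) (ext_int ip (e i) a) =
  \sum_f a f *: \sum_(j < k.+1)
    (-1) ^+ j *: Q (row j (basis_mx f)) (wedge (row' j (basis_mx f))).
Proof.
move=> Qa QD QZ a.
pose L v : {linear ext R n k -> W} :=
  HB.pack (Q v) (GRing.isLinear.Build R _ W _ (Q v) (Qa v)).
have Q0 b : Q 0 b = 0 by rewrite -(scale0r 0) QZ scale0r.
have Qsum (c : 'I_n -> R) b : \sum_i c i *: Q (e i) b = Q (\sum_i c i *: e i) b.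
  elim/big_rec2: _ => [|i x y _ ->]; first by rewrite Q0.
  by rewrite QD QZ.
transitivity (\sum_(i < n) \sum_f a f *: \sum_(j < k.+1)
    ((-1) ^+ j * ip (e i) (row j (basis_mx f))) *:
       Q (e i) (wedge (row' j (basis_mx f)))).
  apply: eq_bigr => i _; rewrite -[LHS]/(L (e i) _) linear_sum.
  apply: eq_bigr => f _; rewrite linearZ linear_sum; congr (_ *: _).
  by apply: eq_bigr => j _; rewrite linearZ.
rewrite exchange_big/=; apply: eq_bigr => f _; rewrite -scaler_sumr.
congr (_ *: _); rewrite exchange_big/=; apply: eq_bigr => j _.
rewrite [in RHS](orthonormal_expansion e_orthonormal (row j (basis_mx f))) -Qsum.
by rewrite scaler_sumr; apply: eq_bigr => i _; rewrite scalerA.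
Qed.

End Contraction.

Section GradedPerpMorphism.
Context {R : realType} {n : nat} (X Y : nat -> lmodType R).
Context (E : 'I_n -> forall k, X k -> X k.+1).
Context (Ed : 'I_n -> forall k, X k.+1 -> X k).
Context (E' : 'I_n -> forall k, Y k -> Y k.+1).
Context (Ed' : 'I_n -> forall k, Y k.+1 -> Y k).
Context (phi : forall k, X k -> Y k).
Hypothesis phi0 : forall k, phi (0 : X k) = 0.
Hypothesis phiD : forall k (x y : X k), phi (x + y) = phi x + phi y.
Hypothesis phiE : forall i k (x : X k), phi (E i x) = E' i (phi x).
Hypothesis phiEd : forall i k (x : X k.+1), phi (Ed i x) = Ed' i (phi x).

Lemma graded_perp_morph m k (a : X m) :
  phi (graded_perp E Ed k a) = graded_perp E' Ed' k (phi a).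
Proof.
rewrite /graded_perp.
have : forall j, phi (in_degree a j) = in_degree (phi a) j.
  by move=> j; rewrite /in_degree; case: eqP => [mj|_]; [case: _ / mj|].
move: (in_degree a) (in_degree (phi a)); elim: (enum 'I_n) k => [|i s IH] k x y xy //=.
by apply: IH => -[|j]; rewrite /clifford phiD phiEd ?phi0 ?phiE !xy.
Qed.

End GradedPerpMorphism.

Section GradedPerpContinuous.
Context {R : realType} {n : nat} (X : nat -> normedModType R).
Context (E : 'I_n -> forall k, X k -> X k.+1).
Context (Ed : 'I_n -> forall k, X k.+1 -> X k).
Hypothesis E_continuous : forall i k, continuous (@E i k).
Hypothesis Ed_continuous : forall i k, continuous (@Ed i k).

Lemma foldl_clifford_continuous (T : topologicalType) (s : seq 'I_n)
    (x : T -> forall j, X j) :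
  (forall j, continuous (fun a => x a j)) ->
  forall k, continuous (fun a =>
    foldl (fun y i => @clifford R n X E Ed i y) (x a) s k).
Proof.
elim: s x => [|i s IH] x xc //=.
apply: IH => -[|j] a; rewrite /clifford.
  apply: cvgD; first exact: cvg_cst.
  by apply: (@continuous_comp _ _ _ (fun a => x a 1%N) (@Ed i 0));
    [exact: xc|exact: Ed_continuous].
apply: cvgD.
  by apply: (@continuous_comp _ _ _ (fun a => x a j) (@E i j));
    [exact: xc|exact: E_continuous].
by apply: (@continuous_comp _ _ _ (fun a => x a j.+2) (@Ed i j.+1));
    [exact: xc|exact: Ed_continuous].
Qed.

Lemma graded_perp_continuous m k :
  continuous (fun a : X m => @graded_perp R n X E Ed m k a).
Proof.
apply: foldl_clifford_continuous => j; rewrite /in_degree; case: eqP => [mj|_].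
  by case: _ / mj => a; exact: cvg_id.
by move=> a; exact: cvg_cst.
Qed.

End GradedPerpContinuous.

Section ChainOperators.
Context {R : realType} {n : nat} (ip : {dot 'rV[R]_n for idfun}).
Context (e : 'I_n -> 'rV[R]_n).
Hypothesis e_orthonormal : forall i j : 'I_n, ip (e i) (e j) = (i == j)%:R.
Context (U : set 'rV[R]_n).

Lemma dirac_map_extension r k m (g : ext R n k -> ext R n m) (g0 : g 0 = 0) :
  linear g -> (exists2 C : R, 0 <= C & forall a, mass ip (g a) <= C * mass ip a) ->
  continuous (extend (fun A => Bembed ip r (dirac_map g0 A)) :
    Bhat ip U r k -> Bhat ip U r m) /\
  (forall A : dirac_chain U k,
    extend (fun A => Bembed ip r (dirac_map g0 A)) (Bembed ip r A) =
    Bembed ip r (dirac_map g0 A) :> Bhat ip U r m).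
Proof.
move=> lg [C C0 gC].
have lf : linear (fun A : dirac_chain U k => Bembed ip r (dirac_map g0 A)).
  by move=> c A B; rewrite dirac_map_linear// Bembed_linear.
have [_ cE EE] := @extend_bounded R _ (Bseminorm ip U r k) (Bhat ip U r m) _ C lf
  (@dirac_map_bounded R n ip U r k m g g0 C lg C0 gC).
by split.
Qed.

Lemma chain_E_extension r v k :
  continuous (@chain_E R n ip U r v k) /\
  (forall A : dirac_chain U k, chain_E v (Bembed ip r A) = Bembed ip r (dirac_E v A)).
Proof.
exact: (@dirac_map_extension r k k.+1 _ (ext_mul0 k v) (ext_mul_linear v)
  (ext_mul_mass e_orthonormal k v)).
Qed.

Lemma chain_Ed_extension r v k :
  continuous (@chain_Ed R n ip U r v k) /\
  (forall A : dirac_chain U k.+1,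
    chain_Ed v (Bembed ip r A) = Bembed ip r (dirac_Ed ip v A)).
Proof.
exact: (@dirac_map_extension r k.+1 k _ (ext_int0 ip k v) (ext_int_linear ip v)
  (ext_int_mass e_orthonormal k v)).
Qed.

Lemma perp_continuous r m k : continuous (@perp R n ip e U r m k).
Proof.
apply: (@graded_perp_continuous R n (fun k => Bhat ip U r k)).
  by move=> i j; exact: (chain_E_extension r (e i) j).1.
by move=> i j; exact: (chain_Ed_extension r (e i) j).1.
Qed.

Lemma perp_embed r m k (A : dirac_chain U m) :
  perp e k (Bembed ip r A) = Bembed ip r (dirac_perp ip e k A).
Proof.
apply/esym; apply: (@graded_perp_morph R n (fun k => dirac_chain U k)
  (fun k => Bhat ip U r k)) => [j|j x y|i j x|i j x].
- exact: Bembed0.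
- exact: BembedD.
- exact/esym/(chain_E_extension r (e i) j).2.
- exact/esym/(chain_Ed_extension r (e i) j).2.
Qed.

End ChainOperators.

(** * Integrals over boundaries *)

Lemma comp_linear (R : realType) (V W X : lmodType R) (f : V -> W) (g : W -> X) :
  linear f -> linear g -> linear (fun x => g (f x)).
Proof. by move=> lf lg c x y; rewrite lf lg. Qed.

Lemma continuous_sum (R : realType) (V W : normedModType R) (I : Type)
    (s : seq I) (f : I -> V -> W) :
  (forall i, continuous (f i)) -> continuous (fun x => \sum_(i <- s) f i x).
Proof.
move=> fc; elim: s => [|i s IH] x.
  rewrite (_ : (fun x => _) = cst 0); first exact: cvg_cst.
  by apply/funext => y; rewrite big_nil.
rewrite (_ : (fun x => _) = (fun y => f i y + \sum_(j <- s) f j y)); last first.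
  by apply/funext => y; rewrite big_cons.
by apply: cvgD; [exact: fc|exact: IH].
Qed.

Section Boundary.
Context {R : realType} {n : nat} (ip : {dot 'rV[R]_n for idfun}).
Context (e : 'I_n -> 'rV[R]_n).
Hypothesis e_orthonormal : forall i j : 'I_n, ip (e i) (e j) = (i == j)%:R.
Context (U : set 'rV[R]_n).
Hypothesis U_open : open U.
Implicit Types (r s k : nat).

Lemma boundary_continuous r k : continuous (@boundary R n ip e U r k).
Proof.
apply: continuous_sum => i J.
have [_ Pc _] := @chain_P_extension R n ip U U_open r (e i) k.
have [Ec _] := @chain_Ed_extension R n ip e e_orthonormal U r (e i) k.
apply: (@continuous_comp _ _ _ (@chain_Ed R n ip U r (e i) k)
  (@chain_P R n ip U r (e i) k)); [exact: Ec|exact: Pc].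
Qed.

Lemma boundary_embed r k (B : dirac_chain U k.+1) :
  boundary e (Bembed ip r B) =
  \sum_(i < n) dirac_chain_P ip (maxn r.+1 2) (e i) (dirac_Ed ip (e i) B).
Proof.
apply: eq_bigr => i _.
have [_ _ PE] := @chain_P_extension R n ip U U_open r (e i) k.
have [_ EE] := @chain_Ed_extension R n ip e e_orthonormal U r (e i) k.
have EP := congr1 (@chain_P R n ip U r (e i) k) (EE B).
exact: (etrans EP (PE _)).
Qed.

Lemma dirac_Ed_dirac v k p (a : ext R n k.+1) : U p ->
  dirac_Ed ip v (dirac_of U (dirac p a)) = dirac_of U (dirac p (ext_int ip v a)).
Proof.
move=> Up; apply: val_inj; rewrite /= !dirac_ofK ?dirac_in_pred//.
exact: (deltas_map [::] _ _ (ext_int_linear ip v)).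
Qed.

Context (k : nat) (w : {linear dirac_chain U k -> R^o}).

Lemma chain_int_extension r : Bform ip r w ->
  [/\ linear (fun J : Bhat ip U r k => chain_int J w : R^o),
      continuous (fun J : Bhat ip U r k => chain_int J w : R^o) &
      forall A, chain_int (Bembed ip r A) w = w A].
Proof.
move=> /(Bform_bounded e_orthonormal)[C _ wC].
exact: (@extend_bounded R _ (Bseminorm ip U r k) R^o w C (linearP w) wC).
Qed.

Section Derivative.
Context (s : nat) (s_ge2 : (2 <= s)%N) (g : Bhat ip U s k -> R^o).
Hypothesis g_linear : linear g.
Hypothesis g_continuous : continuous g.
Hypothesis gE : forall A, g (Bembed ip s A) = w A.

(** Near 0 the functional [g] maps the quotient of (p; a) to that of q |-> w (q; a). *)
Lemma derive_dirac v p (a : ext R n k) : U p ->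
  'D_v (fun q => w (dirac_of U (dirac q a)) : R^o) p = g (link s (dirac_P ip U v p a)).
Proof.
move=> Up; apply: cvg_lim; first exact: norm_hausdorff.
have H := continuous_cvg_comp g_continuous
  (@difference_quotient_dirac R n ip U U_open s v k p a s_ge2 Up).
apply: (near_cvg_eq H); near=> t.
have Ut : U (t *: v + p).
  near: t; apply: cvg_within.
  have c : (fun t : R^o => t *: v + p) @ nbhs (0 : R^o) --> 0 *: v + p.
    by apply: cvgD; [apply: cvgZr_tmp|exact: cvg_cst].
  by apply: c; rewrite scale0r add0r; exact: open_nbhs_nbhs.
pose G : {linear Bhat ip U s k -> R^o} :=
  HB.pack g (GRing.isLinear.Build R _ R^o _ g g_linear).
rewrite /difference_quotient -[LHS]/(G _) linearZ/= gE; congr (_ *: _).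
rewrite dirac_ofK ?dirac_in_pred//.
have -> : delta (t *: v) (dirac p a) = (-1) *: dirac p a + dirac (t *: v + p) a.
  apply/funext => q; rewrite -[LHS]/(dirac p a (q - t *: v) - dirac p a q).
  rewrite -[RHS]/((-1) *: dirac p a q + dirac (t *: v + p) a q) scaleN1r addrC.
  by congr (_ + _); rewrite /dirac subr_eq addrC.
rewrite dirac_of_linear; [|exact: dirac_in_pred..].
by rewrite linearP scaleN1r addrC.
Unshelve. all: by end_near. Qed.

(** By linearity it suffices to consider each point p of the support, where
    [contraction_sum] applies to [Q p]. *)
Lemma boundary_dirac_int (B : dirac_chain U k.+1) :
  g (\sum_(i < n) dirac_chain_P ip s (e i) (dirac_Ed ip (e i) B)) = ext_d w B.
Proof.
pose G : {linear Bhat ip U s k -> R^o} :=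
  HB.pack g (GRing.isLinear.Build R _ R^o _ g g_linear).
have [l [ul sB lU BE]] := dirac_decomposition B.
pose Q p v a := g (link s (dirac_P ip U v p a)) : R^o.
have PEd i : g (dirac_chain_P ip s (e i) (dirac_Ed ip (e i) B)) =
    \sum_(p <- l) Q p (e i) (ext_int ip (e i) (B p)).
  pose f A := g (dirac_chain_P ip s (e i) (dirac_Ed ip (e i) A)) : R^o.
  have lf : linear f.
    apply: comp_linear g_linear; apply: comp_linear.
      exact: dirac_map_linear (ext_int_linear ip (e i)).
    exact: dirac_chain_P_linear.
  pose L : {linear dirac_chain U k.+1 -> R^o} :=
    HB.pack f (GRing.isLinear.Build R _ R^o _ f lf).
  rewrite -[LHS]/(L B) {1}BE linear_sum big_seq [RHS]big_seq.
  apply: eq_bigr => p /lU Up; rewrite -[LHS]/(g _) dirac_Ed_dirac//.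
  congr (g _); exact: dirac_chain_P_dirac.
rewrite -[LHS]/(G _) linear_sum (eq_bigr _ (fun i _ => PEd i)) exchange_big/=.
rewrite /ext_d sB -fsbig_seq// big_seq [RHS]big_seq; apply: eq_bigr => p /lU Up.
rewrite (contraction_sum e_orthonormal (Q := Q p)).
- apply: eq_bigr => f _; congr (_ * _); apply: eq_bigr => j _; congr (_ * _).
  exact/esym/derive_dirac.
- by move=> v; exact: (comp_linear (@dirac_P_vector_linear R n ip U U_open s k s_ge2 v p Up)
    g_linear).
- move=> u v a.
  exact: (etrans (congr1 g (@dirac_P_direction_add R n ip U U_open s k s_ge2 u v p a Up))
    (linearD G _ _)).
- move=> c v a.
  exact: (etrans (congr1 g (@dirac_P_direction_scale R n ip U U_open s k s_ge2 c v p a Up))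
    (linearZ_LR G _ _)).
Qed.

End Derivative.

(** Stokes' theorem on Dirac chains; density extends it to [chain_int_boundary]. *)
Lemma chain_int_boundary_embed r (B : dirac_chain U k.+1) :
  Bform ip (maxn r.+1 2) w ->
  chain_int (boundary e (Bembed ip r B)) w = ext_d w B.
Proof.
move=> /chain_int_extension[lg cg gE].
apply: etrans (boundary_dirac_int (leq_maxr _ _) lg cg gE B).
exact: (congr1 (fun J => chain_int J w) (boundary_embed r B)).
Qed.

Lemma chain_int_boundary_continuous r : Bform ip (maxn r.+1 2) w ->
  continuous (fun K : Bhat ip U r k.+1 => chain_int (boundary e K) w : R^o).
Proof.
move=> /chain_int_extension[_ cg _] K.
apply: (@continuous_comp _ _ _ (@boundary R n ip e U r k)
  (fun J => chain_int J w : R^o)); [exact: boundary_continuous|exact: cg].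
Qed.

Lemma chain_int_boundary r (K : Bhat ip U r k.+1) : Bform ip (maxn r.+1 2) w ->
  chain_int (boundary e K) w = chain_int K (ext_d w).
Proof.
move=> wB; apply/esym; apply: (extend_continuous (W := R^o)
  (@chain_int_boundary_continuous r wB K)) => B.
exact: chain_int_boundary_embed.
Qed.

Lemma chain_int_boundary_perp r m (J : Bhat ip U r m) : Bform ip (maxn r.+1 2) w ->
  chain_int (boundary e (perp e k.+1 J)) w = chain_int J (star ip e (ext_d w)).
Proof.
move=> wB; apply/esym.
apply: (extend_continuous (W := R^o)
  (g := fun J => chain_int (boundary e (perp e k.+1 J)) w)) => [|A].
  apply: (@continuous_comp _ _ _ (@perp R n ip e U r m k.+1)
    (fun K => chain_int (boundary e K) w : R^o)).
    exact: perp_continuous.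
  exact: chain_int_boundary_continuous.
have PE := congr1 (fun K => chain_int (boundary e K) w)
  (@perp_embed R n ip e e_orthonormal U r m k.+1 A).
exact: (etrans PE (@chain_int_boundary_embed r _ wB)).
Qed.

End Boundary.

Section InductiveLimit.
Context {R : realType} {n : nat} (ip : {dot 'rV[R]_n for idfun}).
Context (U : set 'rV[R]_n) (k : nat).

(** The condition under which the integral of [f] makes sense at every order and does not
    depend on it.  It holds for a form [w] bounded in all orders and, through
    [chain_int_boundary_continuous], for its exterior derivative. *)
Definition continuously_extendable (f : dirac_chain U k -> R^o) :=
  forall r, exists2 g : Bhat ip U r k -> R^o,
    continuous g & forall A, g (Bembed ip r A) = f A.

(** Both sides are continuous in [J] and equal [f] on Dirac chains. *)
Lemma chain_int_link f r s (J : Bhat ip U r k) : continuously_extendable f ->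
  (r <= s)%N -> chain_int (link s J) f = chain_int J f.
Proof.
move=> fX rs; have [g gc gE] := fX r; have [h hc hE] := fX s.
have -> : chain_int J f = g J by exact: (extend_continuous (W := R^o) (gc J)).
have -> : chain_int (link s J) f = h (link s J).
  exact: (extend_continuous (W := R^o) (hc _)).
have [_ lc] := @link_extension R n ip U r s k rs.
have hlc : continuous (fun J : Bhat ip U r k => h (link s J)).
  by move=> K; apply: (@continuous_comp _ _ _ (@link R n ip U r s k) h);
    [exact: lc|exact: hc].
have hlE A : h (link s (Bembed ip r A)) = g (Bembed ip r A).
  exact: (etrans (congr1 h (link_embed ip A rs)) (etrans (hE A) (esym (gE A)))).
exact: (@eq_on_embed R _ (Bseminorm ip U r k) R^o _ g hlc gc hlE J).
Qed.

Lemma chain_int_oo_representative f r (J : Bhat ip U r k) : continuously_extendable f ->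
  chain_int_oo (oo_of J) f = chain_int J f.
Proof.
move=> fX; rewrite /chain_int_oo /oo_repr.
have : link_equiv (generic_quotient.repr (oo_of J)) (Tagged (fun s => Bhat ip U s k) J).
  by apply/eqmodP; rewrite reprK.
move=> /asboolP[m [xm ym xy]].
have xyf := congr1 (fun K => chain_int K f) xy.
exact: (etrans (esym (chain_int_link _ fX xm)) (etrans xyf (chain_int_link _ fX ym))).
Qed.

End InductiveLimit.

Theorem corollary9p1p4 (R : realType) (n : nat)
    (ip : {dot 'rV[R]_n for idfun})
    (e : 'I_n -> 'rV[R]_n)
    (e_orthonormal : forall i j : 'I_n, ip (e i) (e j) = (i == j)%:R)
    (U : set 'rV[R]_n) (U_open : open U)
    (k : nat) (k_lt_n : (k < n)%N)
    (w : {linear dirac_chain U k -> R^o}) :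
  (forall (r : nat) (J : Bhat ip U r.-1 (n - k - 1)%N),
     (1 <= r)%N -> Bform ip r w -> (r = 1%N -> Bform ip 2 w) ->
     chain_int (boundary e (perp e k.+1 J)) w =
     chain_int J (star ip e (ext_d w)))
  /\
  (forall J : Bhat_oo ip U (n - k - 1)%N,
     Bform_oo ip w ->
     chain_int_oo (boundary_oo e (perp_oo e k.+1 J)) w =
     chain_int_oo J (star ip e (ext_d w))).
Proof.
split=> [[|[|r]] J // _ w1 w2|J wB].
- by apply: chain_int_boundary_perp => //; exact: w2.
- by apply: chain_int_boundary_perp.
have wX : continuously_extendable ip w.
  move=> r; have [_ cw wE] := chain_int_extension e_orthonormal (wB r).
  by exists (fun K => chain_int K w).
have dwX : continuously_extendable ip (ext_d w).
  move=> r; exists (fun K => chain_int (boundary e K) w).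
    exact: chain_int_boundary_continuous.
  by move=> B; apply: chain_int_boundary_embed.
apply: etrans (chain_int_oo_representative _ wX) _.
apply: etrans (chain_int_boundary e_orthonormal U_open _ (wB _)) _.
apply: etrans (chain_int_oo_representative _ dwX) _.
apply: etrans (esym (chain_int_boundary e_orthonormal U_open _ (wB _))) _.
exact: chain_int_boundary_perp.
Qed.
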